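(* Let $Y=\mathrm{MAX}(L_1)$ and $X=\mathrm{MIN}(\ell_2)$, and let $Q\colon Y\to X$ be a completely bounded surjection which is the composition of a bounded linear surjection $L_1\to\ell_1$ and a bounded linear surjection $\ell_1\to\ell_2$. For each $m\in\mathbb{N}$ let $Y_m$ be the operator space which equals $Y$ as a vector space and has matrix norms $$\|[y_{ij}]\|_{\mathrm{M}_k(Y_m)}=\max\{\|[y_{ij}]\|_{\mathrm{M}_k(Y)},\ 2^m\|[Q(y_{ij})]\|_{\mathrm{M}_k(X)}\},\qquad k\in\mathbb{N},\ [y_{ij}]\in \mathrm{M}_k(Y_m).$$ Then $X$ does not almost completely isomorphically embed into $\mathcal{Z}(Q)=(\bigoplus_m Y_m)_{\ell_1}$.
   Context: $L_1=L_1(0,1)$ with Lebesgue measure. For a Banach space $E$: $\mathrm{MIN}(E)$ is $E$ with the operator space structure coming from the canonical embedding $E\subset C(B_{E^*})$; $\mathrm{MAX}(E)$ is $E$ with $\|[x_{ij}]\|_{\mathrm{M}_k}=\sup_u\|[u(x_{ij})]\|$, the supremum over all linear contractions $u\colon E\to B(H_u)$, $H_u$ Hilbert spaces. The $\ell_1$-sum $(\bigoplus_m Y_m)_{\ell_1}$ is the Banach space of sequences $(y_m)_m$, $y_m\in Y_m$, with $\|(y_m)_m\|=\sum_m\|y_m\|<\infty$, and operator space structure $\|[x_{ij}]\|_{\mathrm{M}_k}=\sup_u\big\|\big[\sum_m u_m(x_{ij}(m))\big]\big\|_{\mathrm{M}_k(B(H_u))}$, the supremum over all Hilbert spaces $H_u$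 and all sequences $u=(u_m)_m$ of completely contractive maps $u_m\colon Y_m\to B(H_u)$. For operator spaces $X,Z$, $X$ almost completely isomorphically embeds into $Z$ if there is a sequence of linear operators $(f^n\colon X\to Z)_n$ such that the amplifications $f^n_n\colon \mathrm{M}_n(X)\to \mathrm{M}_n(Z)$, $f^n_n([x_{ij}])=[f^n(x_{ij})]$ (the $n$-th amplification of the $n$-th map), are isomorphic embeddings with $\sup_n\|f^n_n\|<\infty$ and $\sup_n\|(f^n_n)^{-1}\|<\infty$, the inverses being defined on the images. *)

(* Defs.v *)
From HB Require Import structures.
From mathcomp Require Import all_boot all_order all_algebra.
From mathcomp Require Import complex ring lra.
From mathcomp Require Import all_classical all_reals all_analysis.
From mathcomp Require Import measurable_realfun.
Set Implicit Arguments.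
Unset Strict Implicit.
Unset Printing Implicit Defensive.
Import Order.TTheory GRing.Theory Num.Theory.
Import numFieldNormedType.Exports.
Local Open Scope classical_set_scope.
Local Open Scope complex_scope.
Local Open Scope ring_scope.

(* Norms of normed modules over R[i] take values in R[i]; nrm is the same
   norm with values in R. *)
Definition nrm (R : realType) (V : normedModType R[i]) (x : V) : R :=
  complex.Re `|x|.
Definition cabs (R : realType) (z : R[i]) : R := complex.Re `|z|.

Lemma realcD (R : realType) (x y : R) : (x + y)%:C = x%:C + y%:C :> R[i].
Proof. exact: (rmorphD (real_complex R)). Qed.
Lemma realcM (R : realType) (x y : R) : (x * y)%:C = x%:C * y%:C :> R[i].
Proof. exact: (rmorphM (real_complex R)). Qed.

Section NrmTheory.
Context {R : realType} {V : normedModType R[i]}.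
Implicit Types x y : V.

Lemma cabsE (z : R[i]) : `|z| = (cabs z)%:C.
Proof. by rewrite /cabs RRe_real. Qed.
Lemma cabs_ge0 (z : R[i]) : 0 <= cabs z.
Proof. by rewrite -ler0c -cabsE. Qed.
Lemma cabs0 : cabs (0 : R[i]) = 0.
Proof. by rewrite /cabs normr0. Qed.
Lemma cabs0_eq0 (z : R[i]) : cabs z = 0 -> z = 0.
Proof. by move=> z0; apply/normr0_eq0; rewrite cabsE z0. Qed.
Lemma cabsM (z w : R[i]) : cabs (z * w) = cabs z * cabs w.
Proof. by apply: (@complexI R); rewrite realcM -!cabsE normrM. Qed.
Lemma cabsD (z w : R[i]) : cabs (z + w) <= cabs z + cabs w.
Proof. by rewrite -lecR rmorphD -!cabsE; exact: ler_normD. Qed.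
Lemma cabsV (z : R[i]) : cabs z^-1 = (cabs z)^-1.
Proof.
by apply: (@complexI R); rewrite -cabsE normfV cabsE -(fmorphV (real_complex R)).
Qed.

Lemma nrmE x : `|x| = (nrm x)%:C.
Proof. by rewrite /nrm RRe_real. Qed.
Lemma nrm_ge0 x : 0 <= nrm x.
Proof. by rewrite -ler0c -nrmE. Qed.
Lemma nrm0 : nrm (0 : V) = 0.
Proof. by rewrite /nrm normr0. Qed.
Lemma nrm0_eq0 x : nrm x = 0 -> x = 0.
Proof. by move=> x0; apply/normr0_eq0; rewrite nrmE x0. Qed.
Lemma nrmD x y : nrm (x + y) <= nrm x + nrm y.
Proof. by rewrite -lecR realcD -!nrmE; exact: ler_normD. Qed.
Lemma nrmZ (a : R[i]) x : nrm (a *: x) = cabs a * nrm x.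
Proof.
by apply: (@complexI R); rewrite realcM -(nrmE (a *: x)) normrZ cabsE nrmE.
Qed.
Lemma nrm_sum I (r : seq I) (P : pred I) (F : I -> V) :
  nrm (\sum_(i <- r | P i) F i) <= \sum_(i <- r | P i) nrm (F i).
Proof.
elim/big_rec2: _ => [|i y x _ h]; first by rewrite nrm0.
by rewrite (le_trans (nrmD _ _))// lerD2l.
Qed.

End NrmTheory.

Lemma cabs_nrm (R : realType) (z : R[i]) : cabs z = nrm (z : R[i]^o).
Proof. by []. Qed.

Section SupSeminorm.
Context {R : realType}.

Lemma nneg_sup_ge0 (A : set R) : (forall r, A r -> 0 <= r) -> 0 <= sup A.
Proof.
move=> A0; have [supA|/sup_out->//] := pselect (has_sup A).
have [r Ar] := supA.1; apply: (le_trans (A0 _ Ar)).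
by apply: ub_le_sup => //; exact: supA.2.
Qed.

Lemma supD_le (A B C : set R) :
  (forall r, B r -> 0 <= r) -> (forall r, C r -> 0 <= r) ->
  has_ubound B -> has_ubound C ->
  (forall r, A r -> exists2 s, B s & exists2 t, C t & r <= s + t) ->
  sup A <= sup B + sup C.
Proof.
move=> B0 C0 ubB ubC h; have [A0|/nonemptyPn ->] := pselect (A !=set0).
  apply: ge_sup => // r /h[s Bs [t Ct]] /le_trans; apply.
  by apply: lerD; exact: ub_le_sup.
by rewrite sup0 addr_ge0// nneg_sup_ge0.
Qed.

Lemma supZ_le (a : R) (A B : set R) : 0 <= a ->
  (forall r, B r -> 0 <= r) -> has_ubound B ->
  (forall r, A r -> exists2 s, B s & r <= a * s) -> sup A <= a * sup B.
Proof.
move=> a0 B0 ubB h; have [A0|/nonemptyPn ->] := pselect (A !=set0).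
  apply: ge_sup => // r /h[s Bs] /le_trans; apply.
  by apply: ler_wpM2l => //; exact: ub_le_sup.
by rewrite sup0 mulr_ge0// nneg_sup_ge0.
Qed.

End SupSeminorm.

Section L2n.
Context {R : realType} {V : normedModType R[i]} {k : nat}.
Implicit Types h g : 'I_k -> V.

(* the norm of the k-fold Hilbert sum of V, when V is a Hilbert space *)
Definition l2n h : R := Num.sqrt (\sum_i nrm (h i) ^+ 2).

Lemma l2n_ge0 h : 0 <= l2n h. Proof. exact: sqrtr_ge0. Qed.
Lemma l2n_sqr h : l2n h ^+ 2 = \sum_i nrm (h i) ^+ 2.
Proof. by rewrite sqr_sqrtr// sumr_ge0// => i _; rewrite sqr_ge0. Qed.
Lemma l2n0 : l2n (fun=> 0) = 0.
Proof. by rewrite /l2n big1 ?sqrtr0// => i _; rewrite nrm0 expr0n. Qed.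
Lemma l2nZ (a : R[i]) h : l2n (fun i => a *: h i) = cabs a * l2n h.
Proof.
apply/eqP; rewrite -(@eqrXn2 _ 2)// ?mulr_ge0 ?l2n_ge0 ?cabs_ge0//.
rewrite exprMn !l2n_sqr mulr_sumr; apply/eqP; apply: eq_bigr => i _.
by rewrite nrmZ exprMn.
Qed.

Lemma l2n_cauchy (a b : 'I_k -> R) A B :
  0 <= A -> 0 <= B ->
  \sum_i a i ^+ 2 = A ^+ 2 -> \sum_i b i ^+ 2 = B ^+ 2 ->
  \sum_i a i * b i <= A * B.
Proof.
move=> A0 B0 HA HB.
have [Az|An] := eqVneq A 0.
  have a0 i : a i = 0.
    apply/eqP; rewrite -sqrf_eq0; apply/eqP.
    move: HA; rewrite Az expr0n => /eqP.
    rewrite psumr_eq0; last by move=> j _; exact: sqr_ge0.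
    by move=> /allP/(_ i); rewrite mem_index_enum => /(_ isT) /eqP.
  by rewrite Az mul0r big1// => i _; rewrite a0 mul0r.
have [Bz|Bn] := eqVneq B 0.
  have b0 i : b i = 0.
    apply/eqP; rewrite -sqrf_eq0; apply/eqP.
    move: HB; rewrite Bz expr0n => /eqP.
    rewrite psumr_eq0; last by move=> j _; exact: sqr_ge0.
    by move=> /allP/(_ i); rewrite mem_index_enum => /(_ isT) /eqP.
  by rewrite Bz mulr0 big1// => i _; rewrite b0 mulr0.
have Ap : 0 < A by rewrite lt_def An.
have Bp : 0 < B by rewrite lt_def Bn.
suff : \sum_i (a i * b i) *+ 2 <= (A * B) *+ 2.
  by rewrite sumrMnl lerMn2r.
have -> : (A * B) *+ 2 = \sum_i (B / A * a i ^+ 2 + A / B * b i ^+ 2).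
  rewrite big_split/= -!mulr_sumr HA HB; field.
  by rewrite An Bn.
apply: ler_sum => i _.
have -> : B / A * a i ^+ 2 + A / B * b i ^+ 2
  = (a i * b i) *+ 2 + (B * a i - A * b i) ^+ 2 / (A * B).
  by field; rewrite An Bn.
by rewrite lerDl divr_ge0 ?sqr_ge0// mulr_ge0.
Qed.

Lemma l2nD h g : l2n (fun i => h i + g i) <= l2n h + l2n g.
Proof.
rewrite -ler_sqr// ?nnegrE ?addr_ge0 ?l2n_ge0//.
rewrite sqrrD !l2n_sqr.
have le1 : \sum_i nrm (h i + g i) ^+ 2 <=
    \sum_i nrm (h i) ^+ 2 + (\sum_i nrm (h i) * nrm (g i)) *+ 2
    + \sum_i nrm (g i) ^+ 2.
  rewrite -sumrMnl -!big_split/=; apply: ler_sum => i _.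
  rewrite -sqrrD ler_sqr ?nnegrE ?addr_ge0 ?nrm_ge0//; exact: nrmD.
apply: (le_trans le1); rewrite lerD2r lerD2l lerMn2r/=.
by apply: l2n_cauchy; rewrite ?l2n_ge0// l2n_sqr.
Qed.

Lemma nrm_le_l2n h i : nrm (h i) <= l2n h.
Proof.
rewrite -ler_sqr// ?nnegrE ?nrm_ge0 ?l2n_ge0// l2n_sqr.
by rewrite (bigD1 i)//= lerDl sumr_ge0// => j _; rewrite sqr_ge0.
Qed.

Lemma l2n_le_sum h : l2n h <= \sum_i nrm (h i).
Proof.
have s0 : 0 <= \sum_i nrm (h i) by rewrite sumr_ge0// => i _; exact: nrm_ge0.
rewrite -ler_sqr// ?nnegrE ?l2n_ge0// l2n_sqr expr2 mulr_suml.
apply: ler_sum => i _; rewrite expr2; apply: ler_wpM2l; first exact: nrm_ge0.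
by rewrite (bigD1 i)//= lerDl sumr_ge0// => j _; exact: nrm_ge0.
Qed.

End L2n.

Section BlockNorm.
Context {R : realType} {V : normedModType R[i]} {k : nat}.
Implicit Types (T S : 'M[V -> V]_k) (c : 'I_k -> 'I_k -> R).

(* a k x k matrix of maps V -> V acts on V^k; block_norm is the norm of this
   action for l2n, i.e. the M_k(B(V)) norm when V is a Hilbert space *)
Definition block_app T (h : 'I_k -> V) : 'I_k -> V :=
  fun i => \sum_j T i j (h j).

Definition block_set T : set R :=
  [set l2n (block_app T h) | h in [set h | l2n h <= 1]].

Definition block_norm T : R := sup (block_set T).

Definition block_bdd T c := forall i j h, nrm (T i j h) <= c i j * nrm h.

Lemma block_set_nonempty T : block_set T !=set0.
Proof.
by exists (l2n (block_app T (fun=> 0))), (fun=> 0) => //=; rewrite l2n0.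
Qed.

Lemma block_set_ge0 T r : block_set T r -> 0 <= r.
Proof. by move=> [h _ <-]; exact: l2n_ge0. Qed.

Lemma block_norm_ge0 T : 0 <= block_norm T.
Proof. by apply: nneg_sup_ge0; exact: block_set_ge0. Qed.

Lemma block_set_ub T c : (forall i j, 0 <= c i j) -> block_bdd T c ->
  ubound (block_set T) (\sum_i \sum_j c i j).
Proof.
move=> c0 Tc _ [h h1 <-]; apply: (le_trans (l2n_le_sum _)).
apply: ler_sum => i _; apply: (le_trans (nrm_sum _ _ _)).
apply: ler_sum => j _; apply: (le_trans (Tc _ _ _)).
by rewrite ler_piMr// (le_trans (nrm_le_l2n _ _)).
Qed.

Lemma block_norm_le T c : (forall i j, 0 <= c i j) -> block_bdd T c ->
  block_norm T <= \sum_i \sum_j c i j.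
Proof.
move=> c0 Tc; apply: ge_sup; first exact: block_set_nonempty.
exact: block_set_ub.
Qed.

Lemma block_normD T S :
  has_ubound (block_set T) -> has_ubound (block_set S) ->
  block_norm (T + S) <= block_norm T + block_norm S.
Proof.
move=> Tb Sb; apply: supD_le => //; [exact: block_set_ge0..|].
move=> _ [h h1 <-]; exists (l2n (block_app T h)); first by exists h.
exists (l2n (block_app S h)); first by exists h.
rewrite (_ : block_app (T + S) h = fun i => block_app T h i + block_app S h i).
  exact: l2nD.
by apply/funext => i; rewrite /block_app -big_split;
  apply: eq_bigr => j _; rewrite mxE.
Qed.

Lemma block_normZ_le (a : R[i]) T : has_ubound (block_set T) ->
  block_norm (map_mx ( *:%R a) T) <= cabs a * block_norm T.
Proof.
move=> Tb; apply: supZ_le => //; [exact: cabs_ge0|exact: block_set_ge0|].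
move=> _ [h h1 <-]; exists (l2n (block_app T h)); first by exists h.
rewrite -l2nZ (_ : block_app _ h = fun i => a *: block_app T h i)//.
apply/funext => i; rewrite /block_app scaler_sumr.
by apply: eq_bigr => j _; rewrite mxE.
Qed.

End BlockNorm.

Record hilbertType (R : realType) := HilbertType {
  hilbert_sort :> completeNormedModType R[i];
  hdot : {dot hilbert_sort for Num.conj};
  hdotE : forall x : hilbert_sort, `|x| ^+ 2 = hdot x x }.

(* A vector space with norms on its matrix spaces M_k. Only the seminorm axioms
   are recorded, as they are all that is needed for MIN, MAX, B(H), renormings
   and l_1-sums to be formed. *)
Record mnSpace (R : realType) := MNSpace {
  mn_sort :> lmodType R[i];
  mnorm : forall k, 'M[mn_sort]_k -> R;
  mnormD : forall k (x y : 'M[mn_sort]_k),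
    mnorm (x + y) <= mnorm x + mnorm y;
  mnormZ_le : forall k (a : R[i]) (x : 'M[mn_sort]_k),
    mnorm (map_mx ( *:%R a) x) <= cabs a * mnorm x }.

Section MnTheory.
Context {R : realType} {Y : mnSpace R}.

Lemma mnormZ k (a : R[i]) (x : 'M[Y]_k) :
  mnorm (map_mx ( *:%R a) x) = cabs a * mnorm x.
Proof.
have [->|a0] := eqVneq a 0.
  have e0 (z : 'M[Y]_k) : map_mx ( *:%R 0) z = 0.
    by apply/matrixP => i j; rewrite !mxE scale0r.
  rewrite cabs0 mul0r; apply/eqP; rewrite eq_le; apply/andP; split.
    by have := mnormZ_le 0 x; rewrite cabs0 mul0r.
  have := mnormD (map_mx ( *:%R 0) x) (map_mx ( *:%R 0) x).
  by rewrite !e0 addr0 lerDl.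
have ca : 0 < cabs a.
  rewrite lt_def cabs_ge0 andbT; apply: contra_neq a0; exact: cabs0_eq0.
apply/eqP; rewrite eq_le mnormZ_le/= -ler_pdivlMl// -cabsV.
have xE : x = map_mx ( *:%R a^-1) (map_mx ( *:%R a) x).
  by apply/matrixP => i j; rewrite !mxE scalerA mulVf// scale1r.
by rewrite [in leLHS]xE mnormZ_le.
Qed.

Lemma mnorm0 k : mnorm (0 : 'M[Y]_k) = 0.
Proof.
have -> : 0 = map_mx ( *:%R 0) (0 : 'M[Y]_k).
  by apply/matrixP => i j; rewrite !mxE scale0r.
by rewrite mnormZ cabs0 mul0r.
Qed.

Lemma mnorm_ge0 k (x : 'M[Y]_k) : 0 <= mnorm x.
Proof.
have h : x + map_mx ( *:%R (-1)) x = 0.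
  by apply/matrixP => i j; rewrite !mxE scaleN1r subrr.
have := mnormD x (map_mx ( *:%R (-1)) x).
rewrite h mnorm0 mnormZ (_ : cabs (-1 : R[i]) = 1); last first.
  by rewrite /cabs normrN1.
by rewrite mul1r -mulr2n pmulrn_lge0.
Qed.

(* the norm of M_1(Y) = Y *)
Definition mnorm1 (y : Y) : R := mnorm (const_mx y : 'M[Y]_1).

Lemma mnorm1_ge0 y : 0 <= mnorm1 y. Proof. exact: mnorm_ge0. Qed.
Lemma mnorm10 : mnorm1 0 = 0. 
Proof. by rewrite /mnorm1 (raddf0 (@const_mx _ 1 1)) mnorm0. Qed.
Lemma mnorm1D x y : mnorm1 (x + y) <= mnorm1 x + mnorm1 y.
Proof. by rewrite /mnorm1 (raddfD (@const_mx _ 1 1)) mnormD. Qed.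
Lemma mnorm1Z a x : mnorm1 (a *: x) = cabs a * mnorm1 x.
Proof. by rewrite /mnorm1 -mnormZ map_const_mx. Qed.

End MnTheory.

Section Maps.
Context {R : realType}.

Definition completely_contractive (X Y : mnSpace R) (u : X -> Y) :=
  forall k (x : 'M[X]_k), mnorm (map_mx u x) <= mnorm x.

Definition completely_bounded (X Y : mnSpace R) (u : X -> Y) :=
  exists K : R, forall k (x : 'M[X]_k), mnorm (map_mx u x) <= K * mnorm x.

Definition almost_ci_embeds (X Z : mnSpace R) :=
  exists (f : nat -> {linear X -> Z}) (K L : R), forall n, (0 < n)%N ->
    [/\ injective (fun x : 'M[X]_n => map_mx (f n) x),
        forall x : 'M[X]_n, mnorm (map_mx (f n) x) <= K * mnorm x &
        forall x : 'M[X]_n, mnorm x <= L * mnorm (map_mx (f n) x)].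

End Maps.

Section BoundedOperators.
Context {R : realType} (H : hilbertType R).

Definition bounded_operator : {pred H -> H} :=
  mem [set T : H -> H | linear T /\
        exists M : R, forall h, nrm (T h) <= M * nrm h].

Lemma bounded_operator_submod : submod_closed bounded_operator.
Proof.
split.
  rewrite inE; split; last by exists 0 => h; rewrite mul0r nrm0.
  by move=> a x y; rewrite /= scaler0 addr0.
move=> a T S; rewrite !inE => -[lT [M TM]] [lS [N SN]]; split.
  move=> b x y; rewrite !fctE lT lS !scalerDr !scalerA mulrC.
  by rewrite addrACA.
exists (cabs a * M + N) => h; rewrite !fctE (le_trans (nrmD _ _))//.
by rewrite mulrDl nrmZ -mulrA lerD// ler_wpM2l// cabs_ge0.
Qed.

HB.instance Definition _ := GRing.isSubmodClosed.Build _ _ bounded_operator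
  bounded_operator_submod.

Record BH := BHpack { BH_fun :> H -> H; _ : BH_fun \in bounded_operator }.
HB.instance Definition _ := [isSub for BH_fun].
HB.instance Definition _ := [Choice of BH by <:].
HB.instance Definition _ := [SubChoice_isSubLmodule of BH by <:].

Lemma BH_ub k (T : 'M[BH]_k) : has_ubound (block_set (map_mx BH_fun T)).
Proof.
have bT i j : exists M : R, 0 <= M /\ forall h, nrm (T i j h) <= M * nrm h.
  have := valP (T i j); rewrite inE => -[_ [M TM]].
  exists `|M|; split=> // h; apply: (le_trans (TM h)).
  by rewrite ler_wpM2r ?nrm_ge0// ler_norm.
pose c i j := sval (cid (bT i j)).
exists (\sum_i \sum_j c i j); apply: block_set_ub => [i j|i j h].
  by rewrite /c; case: cid => M [].
by rewrite mxE /c; case: cid => M [].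
Qed.

Definition BHnorm k (T : 'M[BH]_k) : R := block_norm (map_mx BH_fun T).

Lemma BHnormD k (T S : 'M[BH]_k) : BHnorm (T + S) <= BHnorm T + BHnorm S.
Proof.
rewrite /BHnorm (_ : map_mx _ _ = map_mx BH_fun T + map_mx BH_fun S).
  by apply: block_normD; exact: BH_ub.
by apply/matrixP => i j; rewrite !mxE.
Qed.

Lemma BHnormZ_le k (a : R[i]) (T : 'M[BH]_k) :
  BHnorm (map_mx ( *:%R a) T) <= cabs a * BHnorm T.
Proof.
rewrite /BHnorm (_ : map_mx _ _ = map_mx ( *:%R a) (map_mx BH_fun T)).
  by apply: block_normZ_le; exact: BH_ub.
by apply/matrixP => i j; rewrite !mxE.
Qed.

Definition BHspace : mnSpace R := MNSpace BHnormD BHnormZ_le.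

Lemma mnorm1_BH (T : BHspace) h : nrm (BH_fun T h) <= mnorm1 T * nrm h.
Proof.
have lT : linear (BH_fun T) by have := valP T; rewrite inE => -[].
have T0 : BH_fun T 0 = 0.
  by have := lT (-1) 0 0; rewrite scaler0 addr0 scaleN1r addNr.
have [h0|h0] := eqVneq (nrm h) 0.
  by rewrite (nrm0_eq0 h0) T0 nrm0 mulr0.
have hp : 0 < nrm h by rewrite lt_def h0 nrm_ge0.
rewrite -ler_pdivrMr//.
pose g := ((nrm h)^-1)%:C *: h.
have l1 (x : H) : l2n (fun _ : 'I_1 => x) = nrm x.
  by rewrite /l2n big_ord1 sqrtr_sqr ger0_norm// nrm_ge0.
have cE : cabs ((nrm h)^-1)%:C = (nrm h)^-1.
  by apply: (@complexI R); rewrite -cabsE ger0_norm// ler0c invr_ge0 nrm_ge0.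
have lz (a : R[i]) (x : H) : BH_fun T (a *: x) = a *: BH_fun T x.
  by have := lT a x 0; rewrite T0 !addr0.
rewrite mulrC -cE -nrmZ -lz -l1.
apply: ub_le_sup; first exact: BH_ub.
exists (fun=> g); first by rewrite /= l1 /g nrmZ cE mulVf.
by congr l2n; apply/funext => i; rewrite /block_app big_ord1 !mxE.
Qed.

End BoundedOperators.

Section MIN.
Context {R : realType} (E : normedModType R[i]).

(* the norm of M_k(C) = B(C^k) *)
Definition scal_norm k (A : 'M[R[i]]_k) : R :=
  @block_norm R R[i]^o k (map_mx *%R A).

Definition dual_ball : set {linear E -> R[i]^o} :=
  [set phi : {linear E -> R[i]^o} | forall e, `|phi e| <= `|e|].

(* [x_ij] is viewed as the M_k(C)-valued function phi |-> [phi(x_ij)] on the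
   dual ball, M_k(C(K)) = C(K, M_k(C)) carrying the sup norm. *)
Definition MIN_set k (x : 'M[E]_k) : set R :=
  [set scal_norm (map_mx phi x) | phi in dual_ball].

Definition MINnorm k (x : 'M[E]_k) : R := sup (MIN_set x).

Lemma scal_bdd (phi : {linear E -> R[i]^o}) k (x : 'M[E]_k) : dual_ball phi ->
  @block_bdd R R[i]^o k (map_mx *%R (map_mx phi x)) (fun i j => nrm (x i j)).
Proof.
move=> phi1 i j h; rewrite !mxE -!cabs_nrm cabsM ler_wpM2r ?cabs_ge0//.
by rewrite -lecR -cabsE -nrmE phi1.
Qed.

Lemma scal_ub (phi : {linear E -> R[i]^o}) k (x : 'M[E]_k) : dual_ball phi ->
  has_ubound (@block_set R R[i]^o k (map_mx *%R (map_mx phi x))).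
Proof.
move=> phi1; exists (\sum_i \sum_j nrm (x i j)).
apply: (@block_set_ub _ _ _ _ (fun i j => nrm (x i j))); last exact: scal_bdd.
by move=> i j; exact: nrm_ge0.
Qed.

Lemma MIN_set_ub k (x : 'M[E]_k) : has_ubound (MIN_set x).
Proof.
exists (\sum_i \sum_j nrm (x i j)) => _ [phi phi1 <-].
apply: (@block_norm_le _ _ _ _ (fun i j => nrm (x i j))); last exact: scal_bdd.
by move=> i j; exact: nrm_ge0.
Qed.

Lemma MIN_set_ge0 k (x : 'M[E]_k) r : MIN_set x r -> 0 <= r.
Proof. by move=> [phi _ <-]; exact: block_norm_ge0. Qed.

Lemma MINnormD k (x y : 'M[E]_k) : MINnorm (x + y) <= MINnorm x + MINnorm y.
Proof.
apply: supD_le; [exact: MIN_set_ge0|exact: MIN_set_ge0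
  |exact: MIN_set_ub|exact: MIN_set_ub|].
move=> _ [phi phi1 <-]; exists (scal_norm (map_mx phi x)); first by exists phi.
exists (scal_norm (map_mx phi y)); first by exists phi.
rewrite /scal_norm (_ : map_mx _ _ =
    map_mx *%R (map_mx phi x) + map_mx *%R (map_mx phi y)
    :> 'M[R[i]^o -> R[i]^o]_k).
  by apply: block_normD; exact: scal_ub.
by apply/matrixP => i j; rewrite !mxE; apply/funext => z; rewrite linearD mulrDl.
Qed.

Lemma MINnormZ_le k (a : R[i]) (x : 'M[E]_k) :
  MINnorm (map_mx ( *:%R a) x) <= cabs a * MINnorm x.
Proof.
apply: supZ_le;
  [exact: cabs_ge0|exact: MIN_set_ge0|exact: MIN_set_ub|].
move=> _ [phi phi1 <-]; exists (scal_norm (map_mx phi x)); first by exists phi.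
rewrite /scal_norm (_ : map_mx _ _ = map_mx ( *:%R a) (map_mx *%R (map_mx phi x))
    :> 'M[R[i]^o -> R[i]^o]_k).
  by apply: block_normZ_le; exact: scal_ub.
apply/matrixP => i j; rewrite !mxE; apply/funext => z.
by rewrite linearZ /= -mulrA.
Qed.

Definition MIN : mnSpace R := MNSpace MINnormD MINnormZ_le.

End MIN.

Section MAX.
Context {R : realType} (E : normedModType R[i]).

Definition contractive (H : hilbertType R) (u : E -> BHspace H) :=
  forall e, mnorm1 (u e) <= nrm e.

Definition MAX_set k (x : 'M[E]_k) : set R :=
  [set r | exists (H : hilbertType R) (u : {linear E -> BHspace H}),
     contractive u /\ r = mnorm (map_mx u x)].

Definition MAXnorm k (x : 'M[E]_k) : R := sup (MAX_set x).

Lemma MAX_set_ub k (x : 'M[E]_k) : has_ubound (MAX_set x).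
Proof.
exists (\sum_i \sum_j nrm (x i j)) => _ [H [u [u1 ->]]].
apply: (@block_norm_le _ _ _ _ (fun i j => nrm (x i j))) => [i j|i j h].
  exact: nrm_ge0.
rewrite !mxE (le_trans (mnorm1_BH _ _))// ler_wpM2r ?nrm_ge0//.
Qed.

Lemma MAX_set_ge0 k (x : 'M[E]_k) r : MAX_set x r -> 0 <= r.
Proof. by move=> [H [u [_ ->]]]; exact: mnorm_ge0. Qed.

Lemma MAXnormD k (x y : 'M[E]_k) : MAXnorm (x + y) <= MAXnorm x + MAXnorm y.
Proof.
apply: supD_le; [exact: MAX_set_ge0|exact: MAX_set_ge0
  |exact: MAX_set_ub|exact: MAX_set_ub|].
move=> _ [H [u [u1 ->]]]; exists (mnorm (map_mx u x)); first by exists H, u.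
exists (mnorm (map_mx u y)); first by exists H, u.
by rewrite map_mxD mnormD.
Qed.

Lemma MAXnormZ_le k (a : R[i]) (x : 'M[E]_k) :
  MAXnorm (map_mx ( *:%R a) x) <= cabs a * MAXnorm x.
Proof.
apply: supZ_le; [exact: cabs_ge0|exact: MAX_set_ge0|exact: MAX_set_ub|].
move=> _ [H [u [u1 ->]]]; exists (mnorm (map_mx u x)); first by exists H, u.
rewrite -mnormZ (_ : map_mx u _ = map_mx ( *:%R a) (map_mx u x))//.
by apply/matrixP => i j; rewrite !mxE linearZ.
Qed.

Definition MAX : mnSpace R := MNSpace MAXnormD MAXnormZ_le.

End MAX.

Section Renorming.
Context {R : realType} (Y X : mnSpace R) (Q : {linear Y -> X}) (m : nat).

Definition renorm_norm k (y : 'M[Y]_k) : R :=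
  Num.max (mnorm y) (2 ^+ m * mnorm (map_mx Q y)).

Lemma renorm_normD k (x y : 'M[Y]_k) :
  renorm_norm (x + y) <= renorm_norm x + renorm_norm y.
Proof.
rewrite /renorm_norm ge_max; apply/andP; split.
  by rewrite (le_trans (mnormD _ _))// lerD// le_max lexx.
rewrite map_mxD (@le_trans _ _ (2 ^+ m * mnorm (map_mx Q x) +
  2 ^+ m * mnorm (map_mx Q y)))//.
  by rewrite -mulrDr ler_wpM2l ?exprn_ge0// mnormD.
by rewrite lerD// le_max lexx orbT.
Qed.

Lemma renorm_normZ_le k (a : R[i]) (x : 'M[Y]_k) :
  renorm_norm (map_mx ( *:%R a) x) <= cabs a * renorm_norm x.
Proof.
have QE : map_mx Q (map_mx ( *:%R a) x) = map_mx ( *:%R a) (map_mx Q x).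
  by apply/matrixP => i j; rewrite !mxE linearZ.
by rewrite /renorm_norm maxr_pMr ?cabs_ge0// QE !mnormZ
  [X in _ <= Num.max _ X]mulrCA.
Qed.

Definition renorm : mnSpace R := MNSpace renorm_normD renorm_normZ_le.

End Renorming.

Section Product.
Local Notation funextd := functional_extensionality_dep.
Context {R : realType} (Y : nat -> lmodType R[i]).

Definition seqprod : Type := forall m, Y m.

HB.instance Definition _ := gen_eqMixin seqprod.
HB.instance Definition _ := gen_choiceMixin seqprod.

Let addp (x y : seqprod) : seqprod := fun m => x m + y m.
Let oppp (x : seqprod) : seqprod := fun m => - x m.
Let zerop : seqprod := fun=> 0.
Let scalep (a : R[i]) (x : seqprod) : seqprod := fun m => a *: x m.

Let addpA : associative addp.
Proof. by move=> x y z; apply: funextd => m; exact: addrA. Qed.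
Let addpC : commutative addp.
Proof. by move=> x y; apply: funextd => m; exact: addrC. Qed.
Let add0p : left_id zerop addp.
Proof. by move=> x; apply: funextd => m; exact: add0r. Qed.
Let addNp : left_inverse zerop oppp addp.
Proof. by move=> x; apply: funextd => m; exact: addNr. Qed.

HB.instance Definition _ := GRing.isZmodule.Build seqprod
  addpA addpC add0p addNp.

Let scalepA a b (x : seqprod) : scalep a (scalep b x) = scalep (a * b) x.
Proof. by apply: funextd => m; exact: scalerA. Qed.
Let scale1p : left_id 1 scalep.
Proof. by move=> x; apply: funextd => m; exact: scale1r. Qed.
Let scalepDr : right_distributive scalep +%R.
Proof. by move=> a x y; apply: funextd => m; exact: scalerDr. Qed.
Let scalepDl (x : seqprod) : {morph scalep^~ x : a b / a + b}.
Proof. by move=> a b; apply: funextd => m; exact: scalerDl. Qed.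

HB.instance Definition _ := GRing.Zmodule_isLmodule.Build R[i] seqprod
  scalepA scale1p scalepDr scalepDl.

End Product.

Section Ell1Sum.
Context {R : realType} (Y : nat -> mnSpace R).

Definition abs_summable : {pred seqprod Y} :=
  mem [set y : seqprod Y | (\sum_(m <oo) (mnorm1 (y m))%:E < +oo)%E].

Lemma abs_summable_submod : submod_closed abs_summable.
Proof.
split.
  by rewrite inE /= eseries0// => m _ _; rewrite mnorm10.
move=> a x y; rewrite !inE /= => sx sy.
apply: (@le_lt_trans _ _ (\sum_(m <oo)
    ((cabs a)%:E * (mnorm1 (x m))%:E + (mnorm1 (y m))%:E))%E).
  apply: lee_nneseries => [m _ _|m _]; first by rewrite lee_fin mnorm1_ge0.
  by rewrite -EFinM -EFinD lee_fin (le_trans (mnorm1D _ _))// mnorm1Z.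
rewrite nneseriesD; last 2 first.
- by move=> m _ _; rewrite mule_ge0 ?lee_fin ?cabs_ge0 ?mnorm1_ge0.
- by move=> m _ _; rewrite lee_fin mnorm1_ge0.
rewrite nneseriesZl; last by move=> m _; rewrite lee_fin mnorm1_ge0.
by rewrite lte_add_pinfty// lte_mul_pinfty ?lee_fin ?cabs_ge0.
Qed.

HB.instance Definition _ := GRing.isSubmodClosed.Build _ _ abs_summable
  abs_summable_submod.

Record ell1sum_sort := Ell1Sum {
  ell1sum_seq :> seqprod Y; _ : ell1sum_seq \in abs_summable }.
HB.instance Definition _ := [isSub for ell1sum_seq].
HB.instance Definition _ := [Choice of ell1sum_sort by <:].
HB.instance Definition _ := [SubChoice_isSubLmodule of ell1sum_sort by <:].

Section Series.
Variables (H : hilbertType R) (u : forall m, {linear Y m -> BHspace H}).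
Hypothesis u_cc : forall m, completely_contractive (u m).

(* The operator sum_m u_m(y_m): the series converges absolutely in B(H) since
   |u_m(y_m)| <= |y_m|, so that its sum can be computed pointwise. *)
Definition op_series (y : ell1sum_sort) : H -> H :=
  fun h => limn (series (fun m => BH_fun (u m (ell1sum_seq y m)) h)).

Definition ell1bound (y : ell1sum_sort) : R :=
  fine (\sum_(m <oo) (mnorm1 (ell1sum_seq y m))%:E)%E.

Lemma ell1bound_ge0 y : 0 <= ell1bound y.
Proof.
by apply: fine_ge0; apply: nneseries_ge0 => m _ _; rewrite lee_fin mnorm1_ge0.
Qed.

Lemma ell1bound_partial y n :
  \sum_(0 <= m < n) mnorm1 (ell1sum_seq y m) <= ell1bound y.
Proof.
have := valP y; rewrite inE /= => sy.
rewrite -lee_fin /ell1bound fineK; last first.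
  rewrite ge0_fin_numE//; apply: nneseries_ge0 => m _ _.
  by rewrite lee_fin mnorm1_ge0.
rewrite -sumEFin; apply: nneseries_lim_ge => m _ _.
by rewrite lee_fin mnorm1_ge0.
Qed.

Lemma op_term_le y h m :
  nrm (BH_fun (u m (ell1sum_seq y m)) h) <= mnorm1 (ell1sum_seq y m) * nrm h.
Proof.
rewrite (le_trans (mnorm1_BH _ _))// ler_wpM2r ?nrm_ge0//.
have := u_cc (const_mx (ell1sum_seq y m) : 'M[Y m]_1).
by rewrite map_const_mx.
Qed.

Lemma cvg_op_series y h :
  cvgn (series (fun m => BH_fun (u m (ell1sum_seq y m)) h)).
Proof.
have cR : cvgn (series (fun m => mnorm1 (ell1sum_seq y m))).
  apply: nondecreasing_is_cvgn.
    apply/nondecreasing_seqP => n; rewrite seriesSr lerDl; exact: mnorm1_ge0.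
  exists (ell1bound y) => _ [n _ <-]; exact: ell1bound_partial.
apply/cauchy_cvgP/cauchy_seriesP => e e0.
have eE : e = (complex.Re e)%:C by rewrite RRe_real// gtr0_real.
have e0' : 0 < complex.Re e by rewrite -ltcR -eE.
have N0 : 0 < nrm h + 1 by rewrite ltr_wpDl ?nrm_ge0.
move/cauchy_cvgP/cauchy_seriesP : cR => /(_ (complex.Re e / (nrm h + 1))).
rewrite divr_gt0// => /(_ isT); apply: filterS => -[a b] /= hab.
rewrite nrmE eE ltcR (le_lt_trans (nrm_sum _ _ _))//.
apply: (@le_lt_trans _ _ (\sum_(a <= m < b) mnorm1 (ell1sum_seq y m) * nrm h)).
  by apply: ler_sum => m _; exact: op_term_le.
rewrite -mulr_suml.
have s0 : 0 <= \sum_(a <= m < b) mnorm1 (ell1sum_seq y m).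
  by apply: sumr_ge0 => m _; exact: mnorm1_ge0.
rewrite (ger0_norm s0) in hab.
apply: (@le_lt_trans _ _
  ((\sum_(a <= m < b) mnorm1 (ell1sum_seq y m)) * (nrm h + 1))).
  by rewrite ler_wpM2l// lerDl.
by rewrite -ltr_pdivlMr.
Qed.

Lemma op_series_le y h : nrm (op_series y h) <= ell1bound y * nrm h.
Proof.
apply/ler_addgt0Pr => e e0.
have e0' : 0 < e%:C by rewrite (ltcR 0).
have cy : cvgn (series (fun m => BH_fun (u m (ell1sum_seq y m)) h)).
  exact: cvg_op_series.
move/cvgrPdist_lt : cy => /(_ _ e0').
move=> /filter_ex[n]; rewrite nrmE ltcR => hn.
set s := series _ n in hn.
have -> : op_series y h = s + (op_series y h - s) by rewrite addrC subrK.
rewrite (le_trans (nrmD _ _))// lerD//; last exact: ltW.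
rewrite /s /series /= (le_trans (nrm_sum _ _ _))//.
apply: (@le_trans _ _ (\sum_(0 <= m < n) mnorm1 (ell1sum_seq y m) * nrm h)).
  by apply: ler_sum => m _; exact: op_term_le.
by rewrite -mulr_suml ler_wpM2r ?nrm_ge0// ell1bound_partial.
Qed.

Lemma op_seriesD x y : op_series (x + y) = op_series x + op_series y.
Proof.
apply/funext => h; rewrite /op_series fctE; apply/cvg_lim => //.
rewrite (_ : series _ = series (fun m => BH_fun (u m (ell1sum_seq x m)) h) +
    series (fun m => BH_fun (u m (ell1sum_seq y m)) h)).
  by apply: cvgD; exact: cvg_op_series.
apply/funext => n; rewrite fctE /series /= -big_split /=.
by apply: eq_bigr => m _; rewrite linearD.
Qed.

Lemma op_seriesZ a x : op_series (a *: x) = a *: op_series x.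
Proof.
apply/funext => h; rewrite /op_series fctE; apply/cvg_lim => //.
rewrite (_ : series _ =
    a *: series (fun m => BH_fun (u m (ell1sum_seq x m)) h)).
  by apply: cvgZr; exact: cvg_op_series.
apply/funext => n; rewrite fctE /series /= scaler_sumr.
by apply: eq_bigr => m _; rewrite linearZ.
Qed.

Lemma op_series_ub k (x : 'M[ell1sum_sort]_k) :
  ubound (block_set (map_mx op_series x)) (\sum_i \sum_j ell1bound (x i j)).
Proof.
apply: (@block_set_ub _ _ _ _ (fun i j => ell1bound (x i j))) => [i j|i j h].
  exact: ell1bound_ge0.
by rewrite mxE; exact: op_series_le.
Qed.

End Series.

Definition ell1sum_set k (x : 'M[ell1sum_sort]_k) : set R :=
  [set r | exists (H : hilbertType R) (u : forall m, {linear Y m -> BHspace H}),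
     (forall m, completely_contractive (u m)) /\
     r = block_norm (map_mx (op_series u) x)].

Definition ell1sum_norm k (x : 'M[ell1sum_sort]_k) : R := sup (ell1sum_set x).

Lemma ell1sum_set_ub k (x : 'M[ell1sum_sort]_k) : has_ubound (ell1sum_set x).
Proof.
exists (\sum_i \sum_j ell1bound (x i j)) => _ [H [u [u1 ->]]].
apply: ge_sup; first exact: block_set_nonempty.
exact: op_series_ub.
Qed.

Lemma ell1sum_set_ge0 k (x : 'M[ell1sum_sort]_k) r : ell1sum_set x r -> 0 <= r.
Proof. by move=> [H [u [_ ->]]]; exact: block_norm_ge0. Qed.

Lemma ell1sum_normD k (x y : 'M[ell1sum_sort]_k) :
  ell1sum_norm (x + y) <= ell1sum_norm x + ell1sum_norm y.
Proof.
apply: supD_le; [exact: ell1sum_set_ge0|exact: ell1sum_set_ge0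
  |exact: ell1sum_set_ub|exact: ell1sum_set_ub|].
move=> _ [H [u [u1 ->]]]; exists (block_norm (map_mx (op_series u) x)).
  by exists H, u.
exists (block_norm (map_mx (op_series u) y)); first by exists H, u.
rewrite (_ : map_mx _ (x + y) =
    map_mx (op_series u) x + map_mx (op_series u) y).
  by apply: block_normD; eexists; exact: op_series_ub.
by apply/matrixP => i j; rewrite !mxE op_seriesD.
Qed.

Lemma ell1sum_normZ_le k (a : R[i]) (x : 'M[ell1sum_sort]_k) :
  ell1sum_norm (map_mx ( *:%R a) x) <= cabs a * ell1sum_norm x.
Proof.
apply: supZ_le; [exact: cabs_ge0|exact: ell1sum_set_ge0|exact: ell1sum_set_ub|].
move=> _ [H [u [u1 ->]]]; exists (block_norm (map_mx (op_series u) x)).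
  by exists H, u.
rewrite (_ : map_mx (op_series u) _ =
    map_mx ( *:%R a) (map_mx (op_series u) x)).
  by apply: block_normZ_le; eexists; exact: op_series_ub.
by apply/matrixP => i j; rewrite !mxE op_seriesZ.
Qed.

Definition ell1sum : mnSpace R := MNSpace ell1sum_normD ell1sum_normZ_le.

End Ell1Sum.

Section ComplexLp.
Context d (T : measurableType d) (R : realType).
Variables (mu : {measure set T -> \bar R}) (p : R) (p1 : 1 <= p).

(* complex-valued measurable functions with finite Lp norm *)
Definition cLfun_pred : {pred T -> R[i]^o} :=
  mem [set f : T -> R[i]^o |
    [/\ measurable_fun setT (@complex.Re R \o f),
        measurable_fun setT (@complex.Im R \o f) &
        finite_norm mu p%:E (@cabs R \o f)]].

Definition cLnorm (f : T -> R[i]^o) : R :=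
  fine ('N[mu]_p%:E[EFin \o (@cabs R \o f)]).

Let p0 : 0 < p. Proof. exact: lt_le_trans ltr01 p1. Qed.

Let measurable_cabs (f : T -> R[i]^o) :
  measurable_fun setT (@complex.Re R \o f) ->
  measurable_fun setT (@complex.Im R \o f) ->
  measurable_fun setT (@cabs R \o f).
Proof.
move=> mR mI.
rewrite (_ : _ \o _ = (@Num.sqrt R) \o (fun x =>
   (complex.Re (f x)) ^+ 2 + (complex.Im (f x)) ^+ 2)); last first.
  by apply/funext => x /=; rewrite /cabs normc_def.
apply: measurableT_comp.
  by apply: continuous_measurable_fun; exact: sqrt_continuous.
by apply: measurable_funD; exact: measurable_funX.
Qed.

Let cabs_Lfun (f : T -> R[i]^o) :
  f \in cLfun_pred -> @cabs R \o f \in Lfun mu p%:E.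
Proof.
rewrite !inE => -[mR mI fN]; apply/andP; rewrite !inE; split => //.
exact: measurable_cabs.
Qed.

Let LnormD (f g : T -> R[i]^o) :
  f \in cLfun_pred -> g \in cLfun_pred ->
  measurable_fun setT (@cabs R \o (f + g)) ->
  ('N[mu]_p%:E[EFin \o (@cabs R \o (f + g)%R)] <=
   'N[mu]_p%:E[EFin \o (@cabs R \o f)] + 'N[mu]_p%:E[EFin \o (@cabs R \o g)])%E.
Proof.
rewrite !inE => -[fR fI fN] [gR gI gN] mfg.
have mf := measurable_cabs fR fI; have mg := measurable_cabs gR gI.
apply: (@le_trans _ _
  'N[mu]_p%:E[EFin \o ((@cabs R \o f) \+ (@cabs R \o g))%R])%E; last first.
  by apply: eminkowski => //; rewrite lee_fin.
rewrite unlock /Lnorm.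
have mp (h : T -> R) : measurable_fun setT h ->
    measurable_fun setT (fun x => `|(h x)%:E| `^ p)%E.
  move=> mh; apply: (@measurableT_comp _ _ _ _ _ _ (fun x => x `^ p)%E) => //=.
    exact: (measurable_poweR _).
  by apply/measurable_EFinP; exact: measurableT_comp.
rewrite gt0_ler_poweR//.
- by rewrite invr_ge0 ltW.
- by rewrite in_itv/= leey integral_ge0//.
- by rewrite in_itv/= leey integral_ge0//.
- apply: ge0_le_integral => [||||].
  + exact: measurableT.
  + by move=> x _; exact: poweR_ge0.
  + exact: mp.
  + by apply: mp; exact: measurable_funD.
  + move=> x _; rewrite /= lee_fin; apply: ge0_ler_powR => //; first exact: ltW.
    rewrite !ger0_norm ?addr_ge0 ?cabs_ge0//; exact: cabsD.
Qed.

Let LnormZ (f : T -> R[i]^o) (a : R[i]) : f \in cLfun_pred ->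
  ('N[mu]_p%:E[EFin \o (@cabs R \o (a *: f)%R)] =
    (cabs a)%:E * 'N[mu]_p%:E[EFin \o (@cabs R \o f)])%E.
Proof.
move=> /cabs_Lfun fL.
have p1E : (1 <= p%:E)%E by rewrite lee_fin.
have := LnormZ (Lfun_Sub p1E fL) (cabs a).
rewrite ger0_norm ?cabs_ge0// => <-; congr Lnorm.
by apply/funext => x /=; rewrite fctE cabsM.
Qed.

Lemma cLfun_submod_closed : submod_closed cLfun_pred.
Proof.
split.
  rewrite inE; split => /=.
  - by rewrite (_ : _ \o _ = cst 0).
  - by rewrite (_ : _ \o _ = cst 0).
  - rewrite /finite_norm (_ : _ \o _ = cst 0); last first.
      by apply/funext => x /=; rewrite cabs0.
    by rewrite Lnorm0 // eqe gt_eqF.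
move=> a f g fP gP.
have fP' := fP; have gP' := gP.
have afP : a *: f \in cLfun_pred.
  move: fP'; rewrite !inE => -[fR fI fN]; split.
  - rewrite (_ : _ \o _ = (fun x => complex.Re a * complex.Re (f x)
        - complex.Im a * complex.Im (f x))); last first.
      by apply/funext => x /=; rewrite fctE; case: a {fN} => ? ?; case: (f x).
    by apply: measurable_funB; apply: measurable_funM.
  - rewrite (_ : _ \o _ = (fun x => complex.Re a * complex.Im (f x)
        + complex.Im a * complex.Re (f x))); last first.
      by apply/funext => x /=; rewrite fctE; case: a {fN} => ? ?; case: (f x).
    by apply: measurable_funD; apply: measurable_funM.
  - rewrite /finite_norm LnormZ// lte_mul_pinfty ?lee_fin ?cabs_ge0//.
move: (afP) (gP'); rewrite !inE => -[fR fI fN] [gR gI gN].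
have mR : measurable_fun setT (@complex.Re R \o (a *: f + g)).
  rewrite (_ : _ \o _ = (@complex.Re R \o (a *: f)) \+ (@complex.Re R \o g)).
    exact: measurable_funD.
  by apply/funext => x /=; rewrite !fctE; case: (_ *: _) => ? ?; case: (g x).
have mI : measurable_fun setT (@complex.Im R \o (a *: f + g)).
  rewrite (_ : _ \o _ = (@complex.Im R \o (a *: f)) \+ (@complex.Im R \o g)).
    exact: measurable_funD.
  by apply/funext => x /=; rewrite !fctE; case: (_ *: _) => ? ?; case: (g x).
split => //.
apply: (le_lt_trans (LnormD afP gP (measurable_cabs mR mI))).
by rewrite lte_add_pinfty.
Qed.

HB.instance Definition _ := GRing.isSubmodClosed.Build _ _ cLfun_pred
  cLfun_submod_closed.

Record cLfun (q1 : 1 <= p) := CLfun {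
  cLfun_fun :> T -> R[i]^o; _ : cLfun_fun \in cLfun_pred }.
HB.instance Definition _ := [isSub of cLfun p1 for @cLfun_fun p1].
HB.instance Definition _ := [Choice of cLfun p1 by <:].
HB.instance Definition _ := [SubChoice_isSubLmodule of cLfun p1 by <:].

Lemma cLnormE (f : cLfun p1) :
  (cLnorm f)%:E = 'N[mu]_p%:E[EFin \o (@cabs R \o f)]%E.
Proof.
rewrite /cLnorm fineK// ge0_fin_numE ?Lnorm_ge0//.
by have := valP f; rewrite inE => -[].
Qed.

Lemma cLnorm_ge0 (f : cLfun p1) : 0 <= cLnorm f.
Proof. by rewrite -lee_fin cLnormE Lnorm_ge0. Qed.

Lemma measurable_cabs_cLfun (f : cLfun p1) : measurable_fun setT (@cabs R \o f).
Proof. by have := valP f; rewrite inE => -[? ? _]; exact: measurable_cabs. Qed.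

Lemma cLnormD (f g : cLfun p1) : cLnorm (f + g) <= cLnorm f + cLnorm g.
Proof.
have vD : cLfun_fun (f + g) = cLfun_fun f + cLfun_fun g by [].
have mfg := measurable_cabs_cLfun (f + g); rewrite vD in mfg.
by rewrite -lee_fin EFinD !cLnormE vD; apply: LnormD mfg; exact: valP.
Qed.

Lemma cLnormZ (a : R[i]) (f : cLfun p1) : cLnorm (a *: f) = cabs a * cLnorm f.
Proof.
have vZ : cLfun_fun (a *: f) = a *: cLfun_fun f by [].
by apply: EFin_inj; rewrite EFinM !cLnormE vZ; apply: LnormZ; exact: valP.
Qed.

Lemma cLnorm_eq0 (f : cLfun p1) : cLnorm f = 0 -> {ae mu, forall x, f x = 0}.
Proof.
move=> /(congr1 (@EFin R)); rewrite cLnormE => /Lnorm_eq0_eq0.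
have mf : measurable_fun setT (EFin \o (@cabs R \o f)).
  by apply/measurable_EFinP; exact: measurable_cabs_cLfun.
move=> /(_ mf); rewrite lte_fin => /(_ p0); apply: filterS => x /(_ I) [].
exact: cabs0_eq0.
Qed.

End ComplexLp.

Section LpQuotient.
Context d (T : measurableType d) (R : realType).
Variables (mu : {measure set T -> \bar R}) (p : R) (p1 : 1 <= p).
Local Open Scope quotient_scope.

Definition null_cLfun : {pred cLfun mu p1} :=
  mem [set f : cLfun mu p1 | {ae mu, forall x, f x = 0}].

Lemma null_cLfun_submod_closed : submod_closed null_cLfun.
Proof.
split; first by rewrite inE; apply: nearW.
move=> a f g; rewrite !inE; apply: filterS2 => x fx gx.
by rewrite /= !fctE fx gx scaler0 addr0.
Qed.


HB.instance Definition _ := GRing.isSubmodClosed.Build _ _ null_cLfun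
  null_cLfun_submod_closed.

(* L_p(mu): complex-valued functions modulo equality almost everywhere *)
Definition cLp : Type := Quotient.quot null_cLfun.
HB.instance Definition _ := GRing.Zmodule.on cLp.

Definition cLp_class (f : cLfun mu p1) : cLp :=
  \pi_(Quotient.quot null_cLfun) f.
Definition cLp_repr (x : cLp) : cLfun mu p1 :=
  repr (x : Quotient.quot null_cLfun).

Lemma cLp_reprK x : cLp_class (cLp_repr x) = x.
Proof. exact: reprK. Qed.

Lemma cLp_eq f g : cLp_class f = cLp_class g <-> {ae mu, forall x, f x = g x}.
Proof.
have -> : (cLp_class f = cLp_class g) <-> (f - g \in null_cLfun).
  by rewrite Quotient.idealrBE; split => /eqP.
rewrite inE; split; apply: filterS => x /=; rewrite !fctE.
  by move/eqP; rewrite subr_eq0 => /eqP.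
by move=> ->; rewrite subrr.
Qed.

Lemma cLp_classD f g : cLp_class (f + g) = cLp_class f + cLp_class g.
Proof. by rewrite /cLp_class raddfD. Qed.

End LpQuotient.

Section LpNorm.
Context d (T : measurableType d) (R : realType).
Variables (mu : {measure set T -> \bar R}) (p : R) (p1 : 1 <= p).
Local Notation cLp := (cLp mu p1).
Local Notation cLp_class := (@cLp_class _ _ _ mu p p1).

Let cLp_scale (a : R[i]) (x : cLp) : cLp := cLp_class (a *: cLp_repr x).

Let cLp_scaleE a f : cLp_scale a (cLp_class f) = cLp_class (a *: f).
Proof.
apply/cLp_eq; have /cLp_eq := cLp_reprK (cLp_class f).
by apply: filterS => x /= xE; rewrite !fctE xE.
Qed.

Let cLp_scaleA a b x : cLp_scale a (cLp_scale b x) = cLp_scale (a * b) x.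
Proof. by rewrite -(cLp_reprK x) !cLp_scaleE scalerA. Qed.
Let cLp_scale1 : left_id 1 cLp_scale.
Proof. by move=> x; rewrite -(cLp_reprK x) cLp_scaleE scale1r. Qed.
Let cLp_scaleDr : right_distributive cLp_scale +%R.
Proof.
move=> a x y; rewrite -(cLp_reprK x) -(cLp_reprK y) -cLp_classD !cLp_scaleE.
by rewrite scalerDr cLp_classD.
Qed.
Let cLp_scaleDl (x : cLp) : {morph cLp_scale^~ x : a b / a + b}.
Proof.
by move=> a b; rewrite -(cLp_reprK x) !cLp_scaleE scalerDl cLp_classD.
Qed.

HB.instance Definition _ := GRing.Zmodule_isLmodule.Build R[i] cLp
  cLp_scaleA cLp_scale1 cLp_scaleDr cLp_scaleDl.

Lemma cLp_classZ (a : R[i]) f : cLp_class (a *: f) = a *: cLp_class f.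
Proof. by rewrite -cLp_scaleE. Qed.

Lemma cLnorm_null (f : cLfun mu p1) :
  {ae mu, forall x, f x = 0} -> cLnorm mu p f = 0.
Proof.
move=> f0; apply: EFin_inj; rewrite cLnormE unlock /Lnorm.
have p0 : 0 < p := lt_le_trans ltr01 p1.
have -> : (\int[mu]_x `|(EFin \o (@cabs R \o f)) x| `^ p = 0)%E.
  rewrite (@ge0_ae_eq_integral _ T R mu setT _ (cst 0%E)).
  - by rewrite integral0.
  - exact: measurableT.
  - apply: (@measurableT_comp _ _ _ _ _ _ (fun x => x `^ p)%E) => //=.
      exact: (measurable_poweR _).
    apply/measurable_EFinP; apply: measurableT_comp => //.
    exact: measurable_cabs_cLfun.
  - exact: measurable_cst.
  - by move=> x _; exact: poweR_ge0.
  - by [].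
  - apply: filterS f0 => x fx _ /=.
    by rewrite fx cabs0 normr0 powR0// gt_eqF.
by rewrite poweR_EFin powR0// invr_eq0 gt_eqF.
Qed.

Definition cLp_norm (x : cLp) : R := cLnorm mu p (cLp_repr x).

Lemma cLp_norm_class f : cLp_norm (cLp_class f) = cLnorm mu p f.
Proof.
have le (g h : cLfun mu p1) : {ae mu, forall x, g x = h x} ->
    cLnorm mu p g <= cLnorm mu p h.
  move=> gh; have -> : g = (g - h) + h by rewrite subrK.
  rewrite (le_trans (cLnormD _ _))// cLnorm_null ?add0r//.
  by apply: filterS gh => x /= ghx; rewrite !fctE ghx subrr.
have /cLp_eq e := cLp_reprK (cLp_class f).
apply/eqP; rewrite eq_le !le//.
by apply: filterS e => x ->.
Qed.

Let cLp_normC (x : cLp) : R[i] := (cLp_norm x)%:C.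

Let cLp_normCD x y : cLp_normC (x + y) <= cLp_normC x + cLp_normC y.
Proof.
rewrite -(cLp_reprK x) -(cLp_reprK y) -cLp_classD /cLp_normC !cLp_norm_class.
by rewrite -realcD lecR cLnormD.
Qed.

Let cLp_normCZ (a : R[i]) x : cLp_normC (a *: x) = `|a| * cLp_normC x.
Proof.
rewrite -(cLp_reprK x) -cLp_classZ /cLp_normC !cLp_norm_class.
by rewrite cLnormZ realcM cabsE.
Qed.

Let cLp_normC_eq0 x : cLp_normC x = 0 -> x = 0.
Proof.
rewrite -(cLp_reprK x) /cLp_normC cLp_norm_class => /complexI /cLnorm_eq0 h.
have -> : 0 = cLp_class 0 :> cLp.
  by rewrite -[LHS](scale0r (cLp_class 0)) -cLp_classZ scale0r.
by apply/cLp_eq.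
Qed.

HB.instance Definition _ := Lmodule_isNormed.Build R[i] cLp
  cLp_normCD cLp_normCZ cLp_normC_eq0.

Lemma nrm_cLp (x : cLp) : nrm x = cLp_norm x.
Proof. by []. Qed.

End LpNorm.

Section Ellp.
Context (R : realType) (p : R) (p1 : 1 <= p).

(* l_p: all functions on nat are measurable, so that these are the sequences
   with (\sum_n |x_n| ^ p) ^ p^-1 < +oo, see Lnorm_counting *)
Definition ell : Type := cLfun (counting : {measure set nat -> \bar R}) p1.
HB.instance Definition _ := GRing.Lmodule.on ell.

Let ell_normC (x : ell) : R[i] := (cLnorm counting p x)%:C.

Let ell_normCD x y : ell_normC (x + y) <= ell_normC x + ell_normC y.
Proof. by rewrite -realcD lecR cLnormD. Qed.

Let ell_normCZ (a : R[i]) x : ell_normC (a *: x) = `|a| * ell_normC x.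
Proof. by rewrite /ell_normC cLnormZ realcM cabsE. Qed.

Let ell_normC_eq0 x : ell_normC x = 0 -> x = 0.
Proof.
move=> /complexI /cLnorm_eq0 [N [_ N0 sN]].
apply: (@val_inj _ _ (cLfun counting p1)); apply/funext => n.
apply: contrapT => xn.
have Nn : N n by apply: sN.
have : counting N = 0%E :> \bar R by exact: N0.
rewrite /counting; have [finN|infN] := pselect (finite_set N); last first.
  by rewrite asboolF.
rewrite asboolT// => /eqP; rewrite eqe pnatr_eq0 finmap.cardfs_eq0 => /eqP cN.
have NE := fset_set_set0 finN cN.
by move: Nn; rewrite NE.
Qed.

HB.instance Definition _ := Lmodule_isNormed.Build R[i] ell
  ell_normCD ell_normCZ ell_normC_eq0.

Lemma nrm_ell (x : ell) : nrm x = cLnorm counting p x.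
Proof. by []. Qed.

End Ellp.

Definition ell1 (R : realType) : normedModType R[i] := ell (lexx (1 : R)).
Definition ell2 (R : realType) : normedModType R[i] := ell (ler1n R 2).

Definition L1 (R : realType) : normedModType R[i] :=
  cLp (mrestr lebesgue_measure (measurable_itv (`]0, 1[ : interval R)))
    (lexx (1 : R)).

(* m ranges over the positive integers, hence the shift *)
Definition Zspace (R : realType) (Y X : mnSpace R) (Q : {linear Y -> X}) :=
  ell1sum (fun m => renorm Q m.+1).

Definition bounded_map (R : realType) (V W : normedModType R[i]) (f : V -> W) :=
  exists K : R, forall x, nrm (f x) <= K * nrm x.

(* Main.v *)
(* Write e_k for the unit vectors of l_2 and f for the n-th map of a supposed
   almost complete embedding. Each coordinate Q f(.)(m) factors through l_1, so
   by the Schur property Q f(e_k)(m) -> 0, and a gliding hump over m gives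
   sum_m 2^m |Q f(e_k)(m)| -> 0. Hence sum_m |f(e_k)(m)|_{L_1} is bounded below
   for large k, uniformly in n.
   Let n be the size of matrices a_1, ..., a_d satisfying the canonical
   anticommutation relations, so that |sum_p c_p a_p| <= |c|_2: the tensor
   sum_p a_p (x) e_{k_p} then has MIN norm at most 1. If phi_{q,m} is a norming
   functional of f(e_{k_q})(m), then u_m(y) = d^{-1/2} sum_q phi_{q,m}(y) a_q is
   a contraction on L_1, hence completely contractive on Y_m, and evaluating
   sum_m u_m at the image of the tensor on the maximally entangled vector gives
   sum_q sum_m |f(e_{k_q})(m)|_{L_1} <= 2 d^{1/2} |f_n|. The left-hand side is at
   least a constant times d, a contradiction for large d. *)

Require Import Defs.
From HB Require Import structures.
From mathcomp Require Import all_boot all_order all_algebra.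
From mathcomp Require Import complex ring lra.
From mathcomp Require Import all_classical all_reals all_analysis.
Set Implicit Arguments.
Unset Strict Implicit.
Unset Printing Implicit Defensive.
Import Order.TTheory GRing.Theory Num.Theory.
Import numFieldNormedType.Exports.
Local Open Scope classical_set_scope.
Local Open Scope ring_scope.

(** * Norming functionals *)

Section HahnBanach.
Local Open Scope complex_scope.
Context {R : realType} {V : normedModType R[i]}.
Implicit Types (G : set (V * R)) (u v : V * R) (x y z : V) (r t : R).

Lemma cabs_real r : cabs r%:C = `|r|.
Proof. by apply: (@complexI R); rewrite -cabsE normc_def /= expr0n addr0 sqrtr_sqr. Qed.

Lemma nrmN x : nrm (- x) = nrm x.
Proof. by rewrite /nrm normrN. Qed.

(* Graphs of partial real-linear functionals dominated by the norm; domination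
   at 0 makes such a closed relation single-valued. *)
Definition dominated_graph G :=
  (forall u v r, G u -> G v -> G (u.1 + r%:C *: v.1, u.2 + r * v.2)) /\
  (forall u, G u -> u.2 <= nrm u.1).

(** One-step Hahn-Banach extension: domination and the triangle inequality put every
    [u.2 - nrm (u.1 - x0)] below every [nrm (v.1 + x0) - v.2], and the value at [x0] is the supremum
    [al] of the former. *)
Lemma dominated_graph_extend G x0 : dominated_graph G -> G (0, 0) ->
  exists2 G', dominated_graph G' & G `<=` G' /\ exists a, G' (x0, a).
Proof.
move=> [Gl Gd] G0.
have GZ u r : G u -> G (r%:C *: u.1, r * u.2).
  by move=> /(Gl _ _ r G0) /=; rewrite !add0r.
pose S := [set u.2 - nrm (u.1 - x0) | u in G].
have Sub v : G v -> ubound S (nrm (v.1 + x0) - v.2).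
  move=> Gv _ [u Gu <-].
  have := Gd _ (Gl u v 1 Gu Gv); rewrite /= scale1r mul1r => h.
  have h2 : nrm (u.1 + v.1) <= nrm (u.1 - x0) + nrm (v.1 + x0).
    by rewrite (_ : u.1 + v.1 = (u.1 - x0) + (v.1 + x0)) ?nrmD// addrACA addNr addr0.
  by lra.
have S0 : S !=set0 by exists (0 - nrm (0 - x0)); exists (0, 0).
have hS : has_sup S by split => //; exists (nrm (0 + x0) - 0); exact: (Sub (0, 0)).
pose al := sup S.
have al_le v : G v -> al <= nrm (v.1 + x0) - v.2.
  by move=> Gv; apply: ge_sup => //; exact: Sub.
have al_ge v : G v -> v.2 - nrm (v.1 - x0) <= al.
  by move=> Gv; apply: ub_le_sup; [exact: hS.2|exists v].
exists [set w | exists u t, G u /\ w = (u.1 + t%:C *: x0, u.2 + t * al)].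
  split.
    move=> _ _ r [u [t [Gu ->]]] [v [s [Gv ->]]] /=.
    exists (u.1 + r%:C *: v.1, u.2 + r * v.2), (t + r * s).
    split; first exact: Gl.
    rewrite /= realcD realcM scalerDr scalerDl scalerA addrACA; congr (_, _).
    by rewrite mulrDr mulrDl mulrA addrACA.
  move=> _ [u [t [Gu ->]]] /=.
  (* Rescaling [u] by the inverse of |t| reduces domination to [al_le] for positive [t] and to
     [al_ge] for negative [t]. *)
  have [t0|t0|->] := ltgtP t 0; last first.
  - by rewrite mul0r addr0 (_ : 0%:C = 0)// scale0r addr0 Gd.
  - have := al_le _ (GZ u t^-1 Gu); rewrite /= => h.
    have e : u.1 + t%:C *: x0 = t%:C *: (t^-1%:C *: u.1 + x0).
      by rewrite scalerDr scalerA -realcM divff ?gt_eqF// scale1r.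
    rewrite e nrmZ cabs_real gtr0_norm// addrC -lerBrDr.
    rewrite -(ler_pM2l t0) in h; apply: (le_trans h).
    by rewrite mulrBr mulrA divff ?gt_eqF// mul1r.
  - have s0 : 0 < - t by rewrite oppr_gt0.
    have := al_ge _ (GZ u (- t)^-1 Gu); rewrite /= => h.
    have e : u.1 + t%:C *: x0 = (- t)%:C *: ((- t)^-1%:C *: u.1 - x0).
      rewrite scalerBr scalerA -realcM divff ?gt_eqF// scale1r; congr (_ + _).
      by rewrite (_ : (- t)%:C = - t%:C) ?rmorphN// scaleNr opprK.
    rewrite e nrmZ cabs_real gtr0_norm//.
    rewrite -(ler_pM2l s0) mulrBr mulrA divff ?gt_eqF// mul1r in h.
    by lra.
split.
  by move=> [x a] Gu; exists (x, a), 0; split => //=;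
    rewrite mul0r addr0 (_ : 0%:C = 0)// scale0r addr0.
by exists al, (0, 0), 1; split => //=; rewrite scale1r mul1r !add0r.
Qed.

Lemma real_norming z : exists phi : V -> R,
  [/\ forall x y r, phi (x + r%:C *: y) = phi x + r * phi y,
      forall x, phi x <= nrm x & phi z = nrm z].
Proof.
pose L : set (V * R) := [set u | exists r, u = (r%:C *: z, r * nrm z)].
have domL : dominated_graph L.
  split.
    move=> _ _ r [s ->] [t ->]; exists (s + r * t) => /=.
    by rewrite scalerA -realcM -scalerDl -realcD mulrDl mulrA.
  by move=> _ [r ->] /=; rewrite nrmZ cabs_real ler_wpM2r ?nrm_ge0// ler_norm.
(* Zorn's lemma concerns the part added to the line [L], so that the empty chain is covered as
   well. *)
have [|A [domA maxA]] := @Zorn_bigcup _ [set G | dominated_graph (L `|` G)].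
  move=> F FP Ftot /=; split; last first.
    move=> u [Lu|[G FG Gu]]; first exact: domL.2.
    by apply: (FP _ FG).2; right.
  have mem1 G u v r : F G -> (L `|` G) u -> (L `|` G) v ->
      (L `|` \bigcup_(X in F) X) (u.1 + r%:C *: v.1, u.2 + r * v.2).
    by move=> FG Gu Gv; have [?|?] := (FP _ FG).1 u v r Gu Gv; [left|right; exists G].
  move=> u v r [Lu|[G FG Gu]] [Lv|[H FH Hv]].
  - by left; exact: domL.1.
  - by apply: (mem1 H) => //; [left|right].
  - by apply: (mem1 G) => //; [right|left].
  - have [GH|HG] := Ftot _ _ FG FH.
      by apply: (mem1 H) => //; right => //; exact: GH.
    by apply: (mem1 G) => //; right => //; exact: HG.
set B := L `|` A in domA.
have B0 : B (0, 0) by left; exists 0; rewrite scale0r mul0r.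
have tot x : exists a, B (x, a).
  apply: contrapT => nx.
  have [B' domB' [BB' [a B'a]]] := dominated_graph_extend x domA B0.
  apply: (maxA B').
    rewrite properEneq; split; last by move=> u Au; apply: BB'; right.
    by apply/eqP => AB; apply: nx; exists a; right; rewrite AB.
  rewrite /= (_ : L `|` B' = B')//; apply/seteqP; split; last by right.
  by move=> u [Lu|//]; apply: BB'; left.
have fun_le x a b : B (x, a) -> B (x, b) -> a <= b.
  move=> Ba Bb; have := domA.2 _ (domA.1 _ _ (-1) Ba Bb).
  by rewrite /= rmorphN1 scaleN1r subrr nrm0 mulN1r subr_le0.
pose phi x := sval (cid (tot x)).
have Bphi x : B (x, phi x) by rewrite /phi; case: cid.
have phiE x a : B (x, a) -> phi x = a.
  by move=> Ba; apply/eqP; rewrite eq_le !(fun_le x).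
exists phi; split => [x y r|x|].
- by apply: phiE; exact: (domA.1 _ _ r (Bphi x) (Bphi y)).
- exact: domA.2 _ (Bphi x).
- by apply: phiE; left; exists 1; rewrite scale1r mul1r.
Qed.

(** Complexification: phi(x) - i phi(ix) is complex-linear with real part [phi]. At [z] the real
    part is already [nrm z], so the bound on the modulus leaves no imaginary part. *)
Lemma norming z : exists2 psi : {linear V -> R[i]^o},
  dual_ball psi & psi z = (nrm z)%:C.
Proof.
have [phi [phil phi_le phiz]] := real_norming z.
have phi0 : phi 0 = 0.
  by have := phil 0 0 1; rewrite scaler0 addr0 mul1r => h; lra.
have phiZ r x : phi (r%:C *: x) = r * phi x by rewrite -[_ *: _]add0r phil phi0 add0r.
have phiD x y : phi (x + y) = phi x + phi y.
  by have := phil x y 1; rewrite scale1r mul1r.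
pose psi x : R[i]^o := Complex (phi x) (- phi ('i *: x)).
have aE (a : R[i]) x : phi (a *: x) = complex.Re a * phi x + complex.Im a * phi ('i *: x).
  rewrite [in LHS](complexE a) scalerDl phiD phiZ; congr (_ + _).
  by rewrite mulrC -scalerA phiZ.
have psil : linear psi.
  move=> a x y; rewrite /psi phiD.
  have phiN w : phi (- w) = - phi w.
    by rewrite -scaleN1r -(rmorphN1 (real_complex R)) phiZ mulN1r.
  have -> : phi ('i *: (a *: x + y)) =
      complex.Re a * phi ('i *: x) - complex.Im a * phi x + phi ('i *: y).
    rewrite [in LHS]scalerDr phiD [in LHS]scalerA mulrC -scalerA aE.
    by rewrite (scalerA 'i 'i) -expr2 sqr_i scaleN1r phiN mulrN.
  rewrite aE; case: a => a b; apply/eqP; rewrite eq_complex /=.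
  by apply/andP; split; apply/eqP; ring.
pose psiL := GRing.isLinear.Build _ _ _ _ psi psil.
pose Psi : {linear V -> R[i]^o} := HB.pack psi psiL.
have psi1 : dual_ball Psi.
  move=> x; rewrite cabsE nrmE lecR /=.
  have [->|w0] := eqVneq (psi x) 0; first by rewrite cabs0 nrm_ge0.
  have r0 : cabs (psi x) != 0 by apply: contra_neq w0; exact: cabs0_eq0.
  set w := psi x in w0 r0 *; set r := cabs w in r0 *.
  (* The unimodular [c] rotates [psi x] onto its modulus; the value at [c *: x] is then real, hence
     given by [phi], which the norm dominates. *)
  pose c : R[i] := r%:C / w.
  have c1 : cabs c = 1.
    by rewrite /c cabsM cabsV cabs_real ger0_norm ?cabs_ge0// divff.
  have e : Psi (c *: x) = r%:C.
    by rewrite linearZ /= -/w /c /GRing.scale /= divfK.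
  have := phi_le (c *: x); rewrite nrmZ c1 mul1r.
  by move: e => /(congr1 (@complex.Re R)) /= ->.
exists Psi => //; apply/eqP.
have := psi1 z; rewrite cabsE nrmE lecR -ler_sqr ?nnegrE ?cabs_ge0 ?nrm_ge0//.
rewrite /cabs normc_def /= phiz sqr_sqrtr ?addr_ge0 ?sqr_ge0//.
rewrite gerDl => h; rewrite eq_complex /= phiz eqxx /=.
by rewrite -sqrf_eq0 eq_le h sqr_ge0.
Qed.

End HahnBanach.

(** * Finite-dimensional Hilbert spaces *)

Section Euclid.
Local Open Scope complex_scope.
Context (R : realType) (n : nat).

(** A separate name for column vectors, to which the l_2 norm is attached. *)
Definition euclid : Type := 'cV[R[i]]_n.
HB.instance Definition _ := GRing.Lmodule.on euclid.
Implicit Types x y z : euclid.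

Definition coords x : 'I_n -> R[i]^o := fun i => x i 0.
Let euclid_norm x : R[i] := (l2n (coords x))%:C.

Let euclid_normD x y : euclid_norm (x + y) <= euclid_norm x + euclid_norm y.
Proof.
rewrite -realcD lecR (_ : coords (x + y) = fun i => coords x i + coords y i).
  exact: l2nD.
by apply/funext => i; rewrite /coords mxE.
Qed.

Let euclid_normZ (a : R[i]) x : euclid_norm (a *: x) = `|a| * euclid_norm x.
Proof.
rewrite cabsE -realcM -l2nZ; congr (l2n _)%:C.
by apply/funext => i; rewrite /coords mxE.
Qed.

Let euclid_norm_eq0 x : euclid_norm x = 0 -> x = 0.
Proof.
move=> /complexI x0; apply/matrixP => i j; rewrite ord1 mxE.
apply: (@nrm0_eq0 R R[i]^o); apply/eqP; rewrite eq_le nrm_ge0 andbT.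
by rewrite -x0; exact: (nrm_le_l2n (coords x) i).
Qed.

HB.instance Definition _ := Lmodule_isNormed.Build R[i] euclid
  euclid_normD euclid_normZ euclid_norm_eq0.

Lemma nrm_euclid x : nrm x = l2n (coords x).
Proof. by []. Qed.

Lemma cabs_coord_le x i : cabs (x i 0) <= nrm x.
Proof. exact: (nrm_le_l2n (coords x) i). Qed.

Lemma Re_le_cabs (z : R[i]) : `|complex.Re z| <= cabs z.
Proof.
by rewrite /cabs normc_def /= -sqrtr_sqr ler_wsqrtr// lerDl sqr_ge0.
Qed.

Lemma Im_le_cabs (z : R[i]) : `|complex.Im z| <= cabs z.
Proof.
by rewrite /cabs normc_def /= -sqrtr_sqr ler_wsqrtr// lerDr sqr_ge0.
Qed.

Lemma cabs_le_ReIm (z : R[i]) : cabs z <= `|complex.Re z| + `|complex.Im z|.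
Proof.
rewrite /cabs normc_def /= -ler_sqr ?nnegrE ?sqrtr_ge0 ?addr_ge0//.
rewrite sqr_sqrtr ?addr_ge0 ?sqr_ge0// sqrrD !real_normK ?num_real//.
by rewrite lerD2r lerDl mulrn_wge0// mulr_ge0.
Qed.

Lemma euclid_complete (F : set_system euclid) :
  ProperFilter F -> cauchy F -> cvg F.
Proof.
move=> FF /cauchyP Fc.
have cvgf (f : euclid -> R) : (forall x y, `|f x - f y| <= nrm (x - y)) ->
    cvg (f @ F).
  move=> fl; apply: cauchy_cvg; apply/cauchyP => e e0.
  have e0' : 0 < e%:C by rewrite (ltcR 0).
  have [x Fx] := Fc _ e0'; exists (f x).
  suff : ball x e%:C `<=` f @^-1` ball (f x) e by move=> /filterS; exact.
  move=> y; rewrite /preimage /= -!ball_normE /ball_ /= nrmE ltcR => h.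
  exact: le_lt_trans (fl _ _) h.
pose re i x : R := complex.Re (x i 0); pose im i x : R := complex.Im (x i 0).
have cre i : cvg (re i @ F).
  apply: cvgf => x y; apply: le_trans (cabs_coord_le (x - y) i).
  apply: le_trans (Re_le_cabs _); rewrite !mxE /re.
  by case: (x i 0) => ? ?; case: (y i 0).
have cim i : cvg (im i @ F).
  apply: cvgf => x y; apply: le_trans (cabs_coord_le (x - y) i).
  apply: le_trans (Im_le_cabs _); rewrite !mxE /im.
  by case: (x i 0) => ? ?; case: (y i 0).
pose l : euclid := \col_i Complex (lim (re i @ F)) (lim (im i @ F)).
apply/cvg_ex; exists l; apply/cvgrPdist_le => e e0.
have eE : e = (complex.Re e)%:C by rewrite RRe_real// gtr0_real.
have d0 : 0 < complex.Re e by rewrite -ltcR -eE.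
set d := complex.Re e in eE d0.
(* There are 2n real coordinates, each off by at most [eta]; the denominator 2n + 1 also covers n =
   0. *)
pose eta := d / (n.*2.+1)%:R.
have eta0 : 0 < eta by rewrite divr_gt0.
have nre : \forall x \near F, forall i, `|lim (re i @ F) - re i x| <= eta.
  apply: filter_forall => i; have /cvgrPdist_le := cre i; exact.
have nim : \forall x \near F, forall i, `|lim (im i @ F) - im i x| <= eta.
  apply: filter_forall => i; have /cvgrPdist_le := cim i; exact.
near=> x.
rewrite nrmE eE lecR nrm_euclid (le_trans (l2n_le_sum _))//.
apply: (@le_trans _ _ (\sum_(i < n) (eta + eta))).
  apply: ler_sum => i _; rewrite -cabs_nrm /coords.
  apply: (le_trans (cabs_le_ReIm _)); apply: lerD.
    have : `|lim (re i @ F) - re i x| <= eta by move: i; near: x.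
    by rewrite !mxE /re; case: (x i 0).
  have : `|lim (im i @ F) - im i x| <= eta by move: i; near: x.
  by rewrite !mxE /im; case: (x i 0).
rewrite sumr_const card_ord -mulr2n -mulrnA mul2n -mulr_natr /eta mulrAC.
by rewrite ler_pdivrMr// ler_pM2l// ler_nat.
Unshelve. all: by end_near. Qed.

HB.instance Definition _ := Uniform_isComplete.Build euclid euclid_complete.

Definition euclid_dot x y : R[i] := \sum_i x i 0 * Num.conj (y i 0).

Let dot_bilinear : bilinear_for *%R (Num.conj \; *%R) euclid_dot.
Proof.
split=> [y a x x'|x a y y'] /=; rewrite /euclid_dot mulr_sumr -big_split /=;
  apply: eq_bigr => i _; rewrite !mxE.
  by rewrite mulrDl mulrA.
by rewrite rmorphD rmorphM mulrDr mulrCA.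
Qed.

Let dot_hermitian x y : euclid_dot x y = (-1) ^+ false * Num.conj (euclid_dot y x).
Proof.
rewrite expr0 mul1r rmorph_sum; apply: eq_bigr => i _.
by rewrite mulrC rmorphM; congr (_ * _); exact/esym/conjCK.
Qed.

Lemma euclid_dotE x : `|x| ^+ 2 = euclid_dot x x.
Proof.
rewrite nrmE nrm_euclid expr2 -realcM -expr2 l2n_sqr.
rewrite (rmorph_sum (real_complex R)); apply: eq_bigr => i _.
by rewrite -normCK cabsE -cabs_nrm !expr2 -realcM.
Qed.

Let dot_gt0 x : x != 0 -> 0 < euclid_dot x x.
Proof. by move=> x0; rewrite -euclid_dotE exprn_gt0// normr_gt0. Qed.

HB.instance Definition _ :=
  @bilinear_isBilinear.Build _ _ _ _ _ _ euclid_dot dot_bilinear.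
HB.instance Definition _ :=
  @isHermitianSesquilinear.Build _ _ false _ euclid_dot dot_hermitian.
HB.instance Definition _ := @isDotProduct.Build _ _ euclid_dot dot_gt0.

Definition euclidH : hilbertType R :=
  @HilbertType R euclid (euclid_dot : {dot euclid for Num.conj}) euclid_dotE.

End Euclid.

(** * Anticommutation relations *)

Section CAR.
Local Open Scope complex_scope.

(* Half of the canonical anticommutation relations: the products [a p *m a q],
   which would have to anticommute as well, play no role. *)
Definition car (R : nzRingType) d n (a : 'I_d -> 'M[R]_n) :=
  forall p q, a p *m (a q)^T + (a q)^T *m a p = (p == q)%:R%:M.

(** Jordan-Wigner construction, doubling the size at each step. The sign in diag(a, -a) makes the
    old generators anticommute with the new one, and the nilpotent block E satisfies E E^T + E^T E =
    1. *)
Lemma car_exists (R : nzRingType) d :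
  exists n (a : 'I_d -> 'M[R]_n), (0 < n)%N /\ car a.
Proof.
elim: d => [|d [n [a [n0 aP]]]].
  by exists 1%N, (fun=> 0); split => // -[].
exists (n + n)%N, (fun p => if unlift ord0 p is Some p'
  then block_mx (a p') 0 0 (- a p') else block_mx 0 0 1%:M 0).
split; first by rewrite addn_gt0 n0.
have Mb (c : bool) : c%:R%:M = block_mx c%:R%:M 0 0 c%:R%:M :> 'M[R]_(n + n).
  by rewrite -scalar_mx_block.
move=> p q; case: unliftP => [p'|] ->; case: unliftP => [q'|] ->;
  rewrite tr_block_mx !mulmx_block ?trmx0 ?trmx1 ?mulmx0 ?mul0mx ?mulmx1 ?mul1mx
    ?addr0 ?add0r add_block_mx ?addr0 ?add0r ?Mb.
- rewrite (inj_eq lift_inj) raddfN /= !mulmxN !mulNmx !opprK aP.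
  by rewrite ?mulmx0 ?mul0mx ?addr0.
- by rewrite eq_sym (negPf (neq_lift _ _)) addrN raddf0.
- by rewrite (negPf (neq_lift _ _)) raddfN /= addrN raddf0.
- by rewrite eqxx.
Qed.

(** Both products have the same trace by cyclicity. Over the reals the generators are thus
    orthogonal for the Hilbert-Schmidt inner product, with squared norm n/2. *)
Lemma car_trace (R : comNzRingType) d n (a : 'I_d -> 'M[R]_n) p q : car a ->
  (\sum_i \sum_j a p i j * a q i j) *+ 2 = (p == q)%:R * n%:R.
Proof.
move=> /(_ p q) /(congr1 mxtrace).
rewrite mxtraceD mxtrace_scalar mulr_natr (mxtrace_mulC (a q)^T) -mulr2n => <-.
congr (_ *+ 2); apply: eq_bigr => i _; rewrite mxE.
by apply: eq_bigr => j _; rewrite mxE.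
Qed.

Context {R : realType}.

Definition lincomb d n (a : 'I_d -> 'M[R]_n) (c : 'I_d -> R[i]) : 'M[R[i]]_n :=
  \sum_p c p *: map_mx (real_complex R) (a p).

Let star m n (A : 'M[R[i]]_(m, n)) : 'M[R[i]]_(n, m) := (map_mx Num.conj A)^T.

Let starM m n p (A : 'M[R[i]]_(m, n)) (B : 'M[R[i]]_(n, p)) :
  star (A *m B) = star B *m star A.
Proof. by rewrite /star map_mxM trmx_mul. Qed.

Let starK m n (A : 'M[R[i]]_(m, n)) : star (star A) = A.
Proof. by apply/matrixP => i j; rewrite !mxE; exact: conjCK. Qed.

Let star_lincomb d n (a : 'I_d -> 'M[R]_n) c :
  star (lincomb a c) = \sum_p Num.conj (c p) *: (map_mx (real_complex R) (a p))^T.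
Proof.
rewrite /star /lincomb map_mx_sum raddf_sum; apply: eq_bigr => p _ /=.
apply/matrixP => i j; rewrite !mxE rmorphM; congr (_ * _).
by apply/eqP; rewrite eq_complex /= oppr0 !eqxx.
Qed.

Let normE n (v : 'cV[R[i]]_n) :
  (star v *m v) 0 0 = (nrm (v : euclid R n) ^+ 2)%:C.
Proof.
rewrite expr2 realcM -expr2 -nrmE euclid_dotE /euclid_dot mxE.
by apply: eq_bigr => i _; rewrite !mxE mulrC.
Qed.

Lemma lincomb_le d n (a : 'I_d -> 'M[R]_n) c (v : 'cV[R[i]]_n) : car a ->
  nrm (lincomb a c *m v : euclid R n) <=
  Num.sqrt (\sum_p cabs (c p) ^+ 2) * nrm (v : euclid R n).
Proof.
(* [A *m star A + star A *m A] is the scalar [|c|^2]. *)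
move=> aP; set A := lincomb a c; set s := \sum_p _.
have s0 : 0 <= s by apply: sumr_ge0 => p _; exact: sqr_ge0.
have key : A *m star A + star A *m A = (s%:C)%:M.
  rewrite star_lincomb /A /lincomb !mulmx_suml.
  under eq_bigr do rewrite mulmx_sumr.
  under [X in _ + X]eq_bigr do rewrite mulmx_sumr.
  (* Both double sums now run over the same pairs with the same coefficients, so [car] applies pair
     by pair and only p = q survives. *)
  rewrite [X in _ + X]exchange_big -big_split /=.
  rewrite /s (rmorph_sum (real_complex R)) (raddf_sum (@scalar_mx _ n)).
  apply: eq_bigr => p _; rewrite -big_split (bigD1 p)//= [X in _ + X]big1 => [|q qp].
    rewrite addr0 -!scalemxAl -!scalemxAr !scalerA [X in X *: _ + _]mulrC -scalerDr.
    rewrite !matrix.map_trmx -!map_mxM -map_mxD aP eqxx mulrC -normCK.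
    by rewrite map_scalar_mx rmorph1 scalemx1 cabsE !expr2 -realcM.
  rewrite -!scalemxAl -!scalemxAr !scalerA [X in X *: _ + _]mulrC -scalerDr.
  rewrite !matrix.map_trmx -!map_mxM -map_mxD aP eq_sym (negPf qp) raddf0 map_mx0.
  by rewrite scaler0.
(* The quadratic form of [key] at [v]; the term with [star A] is nonnegative and is dropped at the
   end. *)
have : (nrm (A *m v : euclid R n) ^+ 2)%:C + (nrm (star A *m v : euclid R n) ^+ 2)%:C
    = (s * nrm (v : euclid R n) ^+ 2)%:C.
  rewrite realcM -!normE !starM starK addrC.
  have /(congr1 (fun M => (star v *m (M *m v)) 0 0)) := key.
  rewrite mulmxDl mulmxDr mul_scalar_mx -scalemxAr => e.
  transitivity ((s%:C *: (star v *m v)) 0 0); last by rewrite [LHS]mxE.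
  by rewrite -e [RHS]mxE !mulmxA.
rewrite -realcD => /complexI e.
rewrite -ler_sqr ?nnegrE ?mulr_ge0 ?nrm_ge0 ?sqrtr_ge0// exprMn (sqr_sqrtr s0).
by rewrite -[leRHS]e lerDl sqr_ge0.
Qed.

End CAR.

(** * Unit vectors of l_2 and the gliding hump *)

Section SequenceSpaces.
Context {R : realType}.

Lemma ell_nrmE (p : R) (p1 : 1 <= p) (x : ell p1) :
  (nrm x)%:E = ((\sum_(t <oo) (cabs (x t) `^ p)%:E) `^ p^-1)%E.
Proof.
rewrite nrm_ell (@cLnormE _ _ _ counting _ p1 x) Lnorm_counting ?(lt_le_trans ltr01)//.
congr (_ `^ _)%E; apply: eq_eseriesr => t _ /=.
by rewrite ger0_norm ?cabs_ge0.
Qed.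

Lemma ell1_coords_le (x : ell1 R) N :
  \sum_(0 <= t < N) cabs ((x : ell (lexx 1)) t) <= nrm x.
Proof.
rewrite -lee_fin (@ell_nrmE 1 (lexx 1)) invr1 poweRe1; last first.
  by apply: nneseries_ge0 => t _ _; rewrite lee_fin powR_ge0.
under eq_eseriesr do rewrite powRr1 ?cabs_ge0//.
rewrite -sumEFin; apply: nneseries_lim_ge => t _ _.
by rewrite lee_fin cabs_ge0.
Qed.

Lemma ell2_nrm_sqr (x : ell2 R) :
  (nrm x ^+ 2)%:E = (\sum_(t <oo) (cabs ((x : ell (ler1n R 2)) t) ^+ 2)%:E)%E.
Proof.
have -> : (nrm x ^+ 2)%:E = ((nrm x)%:E `^ 2)%E.
  by rewrite poweR_EFin -powR_mulrn ?nrm_ge0.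
rewrite (@ell_nrmE 2 (ler1n R 2)) -poweRrM mulVf// poweRe1; last first.
  by apply: nneseries_ge0 => t _ _; rewrite lee_fin powR_ge0.
by apply: eq_eseriesr => t _; rewrite powR_mulrn ?cabs_ge0.
Qed.

Lemma nneseries_single_lty (k : nat) (f : nat -> \bar R) :
  (forall t, 0 <= f t)%E -> (forall t, t != k -> f t = 0%E) -> (f k < +oo)%E ->
  (\sum_(t <oo) f t < +oo)%E.
Proof.
move=> f0 fk fy; rewrite (@nneseriesD1 _ _ k)//.
by rewrite eseries0 ?adde0// => t _ /fk.
Qed.

Lemma cLfun_delta (k : nat) :
  (fun t : nat => (t == k)%:R : R[i]^o) \in cLfun_pred counting (2 : R).
Proof.
rewrite inE; split.
- by move=> _ A mA.
- by move=> _ A mA.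
rewrite /finite_norm Lnorm_counting//; apply: poweR_lty.
apply: (@nneseries_single_lty k) => [t|t tk|].
- exact: poweR_ge0.
- by rewrite /= (negPf tk) cabs0 normr0 powR0.
- exact: ltry.
Qed.

Definition ell2_delta (k : nat) : ell2 R :=
  @CLfun _ _ R counting 2 (ler1n R 2) _ (cLfun_delta k).

Lemma ell2_sum_delta_coord (s : seq nat) (c : nat -> R[i]) (t : nat) : uniq s ->
  ((\sum_(k <- s) c k *: ell2_delta k : ell2 R) : ell (ler1n R 2)) t
    = c t *+ (t \in s).
Proof.
elim: s => [|k s IH] /=; first by rewrite big_nil.
move=> /andP[ks us]; rewrite big_cons inE.
rewrite -[LHS]/(c k * (t == k)%:R +
  ((\sum_(k <- s) c k *: ell2_delta k : ell2 R) : ell (ler1n R 2)) t) IH//.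
have [->|_] := eqVneq t k; last by rewrite mulr0 add0r.
by rewrite (negPf ks) addr0 mulr1.
Qed.

Lemma nrm_ell2_sum_delta (s : seq nat) (c : nat -> R[i]) : uniq s ->
  nrm (\sum_(k <- s) c k *: ell2_delta k) ^+ 2 = \sum_(k <- s) cabs (c k) ^+ 2.
Proof.
move=> us; apply: EFin_inj; rewrite ell2_nrm_sqr.
under eq_eseriesr do rewrite ell2_sum_delta_coord//.
elim: s us => [_|k s IH] /=.
  by rewrite big_nil eseries0// => t _ _; rewrite mulr0n cabs0 expr0n.
move=> /andP[ks us]; rewrite big_cons EFinD -(IH us).
have f0 (s' : seq nat) t : (0 <= (cabs (c t *+ (t \in s')) ^+ 2)%:E)%E.
  by rewrite lee_fin sqr_ge0.
rewrite (@nneseriesD1 _ _ k)// [in RHS](@nneseriesD1 _ _ k)//.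
rewrite mem_head mulr1n (negPf ks) mulr0n cabs0 expr0n add0e; congr (_ + _)%E.
by apply: eq_eseriesr => t /andP[_ tk]; rewrite inE (negPf tk).
Qed.

Lemma nrm_ell2_delta k : nrm (ell2_delta k) = 1.
Proof.
have := @nrm_ell2_sum_delta [:: k] (fun=> 1) isT.
rewrite !big_seq1 scale1r (_ : cabs 1 = 1 :> R) ?expr1n; last first.
  by rewrite (cabs_real 1) normr1.
move/eqP; rewrite sqrf_eq1 => /orP[/eqP//|/eqP h].
by have := nrm_ge0 (ell2_delta k); rewrite h ler0N1.
Qed.

(** Duality: at the vector with coefficients conj(phi(e_k)), of norm sqrt S, the functional takes
    the value S, whence S <= C sqrt S. *)
Lemma bessel_delta (phi : {linear ell2 R -> R[i]^o}) C (s : seq nat) :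
  (forall x, cabs (phi x) <= C * nrm x) -> uniq s ->
  \sum_(k <- s) cabs (phi (ell2_delta k)) ^+ 2 <= C ^+ 2.
Proof.
move=> phiC us; set S := \sum_(k <- s) _.
have S0 : 0 <= S by apply: sumr_ge0 => k _; exact: sqr_ge0.
pose c k := Num.conj (phi (ell2_delta k)).
have cc k : cabs (c k) = cabs (phi (ell2_delta k)).
  by rewrite /cabs /c norm_conjC.
have xS : nrm (\sum_(k <- s) c k *: ell2_delta k) ^+ 2 = S.
  by rewrite nrm_ell2_sum_delta//; apply: eq_bigr => k _; rewrite cc.
have := phiC (\sum_(k <- s) c k *: ell2_delta k).
have -> : phi (\sum_(k <- s) c k *: ell2_delta k) = S%:C%C.
  rewrite linear_sum /S (rmorph_sum (real_complex R)); apply: eq_bigr => k _.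
  by rewrite linearZ /= /c /GRing.scale /= mulrC -normCK cabsE !expr2 -realcM.
rewrite cabs_real ger0_norm//; set N := nrm _ in xS * => h.
have N0 : 0 <= N by exact: nrm_ge0.
have [->|Sn] := eqVneq S 0; first exact: sqr_ge0.
have Sp : 0 < S by rewrite lt_def Sn.
have : S ^+ 2 <= C ^+ 2 * S.
  rewrite -xS -exprMn -[X in X ^+ 2 <= _]/(N ^+ 2) ler_sqr ?nnegrE ?sqr_ge0//; last first.
    exact: le_trans S0 h.
  by rewrite xS.
by rewrite expr2 ler_pM2r.
Qed.

End SequenceSpaces.

Section GlidingHump.
Context {R : realType}.
Implicit Types (x : ell2 R) (eps : R).

Lemma bounded_series_tail (u : nat -> R) C eps N : (forall j, 0 <= u j) ->
  (forall M, \sum_(0 <= j < M) u j <= C) -> 0 < eps ->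
  exists2 M, (N <= M)%N & forall P, \sum_(M <= j < P) u j <= eps.
Proof.
move=> u0 uC eps0; pose S := range (fun M => \sum_(0 <= j < M) u j).
have supS : has_sup S.
  split; first by exists (\sum_(0 <= j < 0) u j); exists 0%N.
  by exists C => _ [M _ <-].
have [_ [M1 _ <-] hM1] := sup_adherent eps0 supS.
exists (maxn N M1); first exact: leq_maxl.
move=> P; have [hP|hP] := leqP (maxn N M1) P; last first.
  by rewrite big_geq ?(ltW eps0)// ltnW.
have : \sum_(0 <= j < P) u j <= sup S.
  by apply: ub_le_sup; [exact: supS.2|exists P].
rewrite (big_cat_nat (leq0n _) hP)//= (big_cat_nat (leq0n _) (leq_maxr N M1))//=.
have : 0 <= \sum_(M1 <= j < maxn N M1) u j by exact: sumr_ge0.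
by lra.
Qed.

(** If the conclusion fails for [eps], unit vectors are added one at a time, each carrying its mass
    at indices j where the earlier sum has almost none. A sum of r of them has norm sqrt r but total
    at least r eps/2, which exceeds C sqrt r for large r. *)
Lemma gliding_hump (p : nat -> ell2 R -> R) C :
  (forall j x, 0 <= p j x) -> (forall j x, p j (- x) = p j x) ->
  (forall j x y, p j (x + y) <= p j x + p j y) ->
  (forall x N, \sum_(0 <= j < N) p j x <= C * nrm x) ->
  (forall j eps, 0 < eps -> \forall k \near \oo, p j (ell2_delta k) <= eps) ->
  forall eps, 0 < eps -> \forall k \near \oo,
    forall N, \sum_(0 <= j < N) p j (ell2_delta k) <= eps.
Proof.
move=> p0 pN pD pC pd eps eps0; apply: contrapT => nh.
have frequently K : exists k N, (K <= k)%N /\ eps < \sum_(0 <= j < N) p j (ell2_delta k).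
  apply: contrapT => nk; apply: nh; exists K => // k /= Kk N.
  rewrite leNgt; apply/negP => h; apply: nk; by exists k, N.
have pB j x y : p j x - p j y <= p j (x + y).
  by rewrite lerBlDr; have := pD j (x + y) (- y); rewrite addrK pN.
have claim r : exists s N, [/\ uniq s, size s = r &
    eps / 2 * r%:R <= \sum_(0 <= j < N) p j (\sum_(k <- s) ell2_delta k)].
  elim: r => [|r [s [N [us <- sN]]]].
    by exists [::], 0%N; split => //; rewrite mulr0 big_geq.
  set x := \sum_(k <- s) _ in sN.
  (* Three errors [eta] occur: the new unit vector before [M], counted twice, and the old sum [x]
     after [M]. They cost eps/2 of the gain eps. *)
  pose eta := eps / 6.
  have eta0 : 0 < eta by rewrite divr_gt0.
  have [M NM xM] := bounded_series_tail N (p0^~ x) (pC x) eta0.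
  have nM : \forall k \near \oo, \sum_(0 <= j < M) p j (ell2_delta k) <= eta.
    have M0 : 0 < M.+1%:R :> R by [].
    have : \forall k \near \oo, forall j : 'I_M, p j (ell2_delta k) <= eta / M.+1%:R.
      by apply: filter_forall => j; apply: pd; rewrite divr_gt0.
    apply: filterS => k hk; rewrite big_mkord.
    apply: (@le_trans _ _ (\sum_(j < M) eta / M.+1%:R)); first exact: ler_sum.
    rewrite sumr_const card_ord -[leLHS]mulr_natr mulrAC ler_pdivrMr// ler_pM2l//.
    by rewrite ler_nat.
  have [K0 _ hK0] := nM.
  (* Beyond [K0] the new unit vector is small before [M]; beyond all of [s] its index is new. *)
  have [k [P [Kk kP]]] := frequently (maxn K0 (\max_(i <- s) i).+1).
  have {}hK0 := hK0 k (leq_trans (leq_maxl _ _) Kk).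
  have ks : k \notin s.
    apply/negP => ks; have := leq_trans (leq_maxr _ _) Kk.
    by rewrite ltnNge (@leq_bigmax_seq _ _ xpredT id)//.
  have MP : (M <= P)%N.
    rewrite leqNgt; apply/negP => PM; move: kP; rewrite ltNge => /negP; apply.
    apply: (@le_trans _ _ (\sum_(0 <= j < M) p j (ell2_delta k))).
      rewrite (big_cat_nat (leq0n _) (ltnW PM))//= lerDl; exact: sumr_ge0.
    by rewrite (le_trans hK0)// /eta ler_pdivrMr// ler_peMr// ?ler1n// ltW.
  exists (k :: s), P; split => //=; first by rewrite ks.
  rewrite big_cons -/x (big_cat_nat (leq0n _) MP)//=.
  have h1 : \sum_(0 <= j < M) p j x - \sum_(0 <= j < M) p j (ell2_delta k) <=
      \sum_(0 <= j < M) p j (ell2_delta k + x).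
    by rewrite -sumrB (addrC (ell2_delta k)); apply: ler_sum.
  have h2 : \sum_(M <= j < P) p j (ell2_delta k) - \sum_(M <= j < P) p j x <=
      \sum_(M <= j < P) p j (ell2_delta k + x).
    by rewrite -sumrB; apply: ler_sum => j _.
  have h3 : \sum_(0 <= j < N) p j x <= \sum_(0 <= j < M) p j x.
    rewrite (big_cat_nat (leq0n _) NM)//= lerDl; exact: sumr_ge0.
  move: kP; rewrite (big_cat_nat (leq0n _) MP)//= => kP.
  have := xM P; rewrite /eta in hK0 * => xMP.
  by rewrite -[(size s).+1%:R]natr1 mulrDr; lra.
(* With y = sqrt r, the claim and the bound by C give (eps/2) y^2 <= C y, that is y <= [D]; hence r
   is taken above the square of [D]. *)
pose D := `|C| * 2 / eps.
have D0 : 0 <= D by rewrite mulr_ge0 ?invr_ge0 ?(ltW eps0)// mulr_ge0.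
have [r rD] : exists r, D ^+ 2 < r%:R.
  by exists (Num.bound (D ^+ 2)); rewrite archi_boundP// sqr_ge0.
have [s [N [us sr h]]] := claim r.
have {}h := le_trans h (pC _ N).
have ns : nrm (\sum_(k <- s) ell2_delta k : ell2 R) ^+ 2 = r%:R.
  have := @nrm_ell2_sum_delta R s (fun=> 1) us.
  under eq_bigr do rewrite scale1r.
  move=> ->; rewrite (eq_bigr (fun=> 1)) => [|k _]; last first.
    by rewrite (cabs_real 1) normr1 expr1n.
  by rewrite big_const_seq count_predT sr iter_addr_0.
set y := nrm _ in h ns.
have y0 : 0 <= y by exact: nrm_ge0.
have yp : 0 < y.
  rewrite lt_def y0 andbT; apply/eqP => y00; move: rD.
  by rewrite -ns y00 expr0n ltNge sqr_ge0.
have : y <= D.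
  rewrite -ns in h; rewrite /D ler_pdivlMr// -(ler_pM2r yp).
  have := ler_norm C => hC.
  have := ler_wpM2r y0 hC; move: h; rewrite expr2; lra.
move=> yD; move: rD; rewrite ltNge => /negP; apply.
by rewrite -ns ler_sqr ?nnegrE.
Qed.

End GlidingHump.

(** * Matrix norms of MIN, MAX and l_1-sums *)

Section MatrixOperators.
Context {R : realType} {n : nat}.
Implicit Types (A : 'M[R[i]]_n) (h : euclid R n).

Definition mulmx_euclid A : euclidH R n -> euclidH R n :=
  fun h => A *m (h : 'cV_n) : euclid R n.

Lemma mulmx_bounded A : mulmx_euclid A \in @bounded_operator R (euclidH R n).
Proof.
rewrite inE; split.
  by move=> c x y; rewrite /mulmx_euclid (mulmxDr A (c *: x : 'cV_n)) -scalemxAr.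
exists (\sum_i \sum_j cabs (A i j)) => h.
rewrite [leLHS](nrm_euclid (A *m (h : 'cV_n) : euclid R n)).
rewrite (le_trans (l2n_le_sum _))// mulr_suml; apply: ler_sum => i _.
rewrite /coords mxE (le_trans (nrm_sum _ _ _))// mulr_suml.
apply: ler_sum => j _; rewrite -cabs_nrm cabsM ler_wpM2l ?cabs_ge0//.
exact: (cabs_coord_le (h : euclid R n)).
Qed.

Definition opmx A : BH (euclidH R n) := BHpack (mulmx_bounded A).

Lemma opmx_is_linear : linear opmx.
Proof.
move=> c A B; apply: val_inj; apply/funext => h /=.
by rewrite /mulmx_euclid mulmxDl -scalemxAl.
Qed.
HB.instance Definition _ := GRing.isLinear.Build R[i] 'M[R[i]]_n
  (BH (euclidH R n)) _ opmx opmx_is_linear.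

Lemma contractive_opmx (V : normedModType R[i]) (A : {linear V -> 'M[R[i]]_n}) :
  (forall y h, nrm (A y *m (h : 'cV_n) : euclid R n) <= nrm y * nrm h) ->
  contractive (fun y => opmx (A y) : BHspace (euclidH R n)).
Proof.
move=> hA y.
rewrite [leRHS](_ : _ = \sum_(i < 1) \sum_(j < 1) nrm y); last by rewrite !big_ord1.
apply: (@block_norm_le R (euclidH R n) 1 _ (fun _ _ => nrm y)).
  by move=> *; exact: nrm_ge0.
by move=> i j h; rewrite !mxE; exact: hA.
Qed.

End MatrixOperators.

Section Corner.
Context {R : realType} {n : nat} (i0 : 'I_n).

(** The n-th map of an almost complete embedding is controlled on matrices of size n, and [mnSpace]
    does not relate different sizes; estimates for single vectors are therefore read off at a corner
    entry. *)
Definition corner (U : zmodType) (z : U) : 'M[U]_n :=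
  \matrix_(i, j) (z *+ ((i == i0) && (j == i0))).

Lemma map_corner (U V : zmodType) (f : {additive U -> V}) z :
  map_mx f (corner z) = corner (f z).
Proof. by apply/matrixP => i j; rewrite !mxE raddfMn. Qed.

Lemma sum_corner (U : zmodType) (c : U -> R) z : c 0 = 0 ->
  \sum_i \sum_j c (corner z i j) = c z.
Proof.
move=> c0; rewrite (bigD1 i0)//= [X in _ + X]big1 ?addr0 => [|i ii]; last first.
  by rewrite big1// => j _; rewrite mxE (negPf ii) c0.
rewrite (bigD1 i0)//= [X in _ + X]big1 ?addr0 => [|j jj]; last first.
  by rewrite mxE (negPf jj) andbF c0.
by rewrite mxE eqxx.
Qed.

Definition delta_vec (V : zmodType) (v : V) : 'I_n -> V := fun i => v *+ (i == i0).

Lemma l2n_delta_vec (V : normedModType R[i]) (v : V) :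
  l2n (delta_vec v) = nrm v.
Proof.
rewrite /l2n (bigD1 i0)//= big1 => [|i /negPf ii].
  by rewrite /delta_vec eqxx addr0 sqrtr_sqr ger0_norm ?nrm_ge0.
by rewrite /delta_vec ii nrm0 expr0n.
Qed.

Lemma MIN_corner_le (E : normedModType R[i]) (x : E) :
  mnorm (corner x : 'M[MIN E]_n) <= nrm x.
Proof.
apply: ge_sup.
  exists (scal_norm (map_mx (\0 : {linear E -> R[i]^o}) (corner x))).
  by exists \0 => //= e; rewrite normr0.
move=> _ [phi phi1 <-].
rewrite -[leRHS](@sum_corner E (fun x => nrm x)) ?nrm0//.
apply: (@block_norm_le _ _ _ _ (fun i j => nrm (corner x i j))).
  by move=> *; exact: nrm_ge0.
exact: scal_bdd.
Qed.

Lemma MIN_corner_ge (E : normedModType R[i]) (x : E) :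
  nrm x <= mnorm (corner x : 'M[MIN E]_n).
Proof.
have [phi phi1 phix] := norming x.
apply: (@le_trans _ _ (scal_norm (map_mx phi (corner x)))); last first.
  by apply: ub_le_sup; [exact: MIN_set_ub|exists phi].
apply: le_trans; last first.
  apply: ub_le_sup; first exact: (scal_ub (corner x) phi1).
  exists (delta_vec (1 : R[i]^o)) => //=.
  by rewrite l2n_delta_vec -cabs_nrm (cabs_real 1) normr1.
apply: le_trans; last exact: (nrm_le_l2n _ i0).
rewrite /block_app (bigD1 i0)//= big1 => [|j jj]; last first.
  by rewrite !mxE /delta_vec (negPf jj) mulr0n mulr0.
rewrite !mxE /delta_vec !eqxx !mulr1n mulr1 addr0 -cabs_nrm phix cabs_real.
by rewrite ger0_norm ?nrm_ge0.
Qed.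

Lemma ell1sum_corner_le (Y : nat -> mnSpace R) (z : ell1sum Y) :
  mnorm (corner z : 'M[ell1sum Y]_n) <= ell1bound z.
Proof.
have b0 : ell1bound (0 : ell1sum Y) = 0.
  by rewrite /ell1bound eseries0// => m _ _; rewrite mnorm10.
rewrite [leLHS]/mnorm /= /ell1sum_norm.
have [ne|/nonemptyPn ->] := pselect (ell1sum_set (corner z) !=set0); last first.
  by rewrite sup0 ell1bound_ge0.
apply: ge_sup => // _ [H [u [u1 ->]]].
rewrite -[leRHS](@sum_corner (ell1sum_sort Y) (fun z => ell1bound z)) ?b0//.
apply: ge_sup; first exact: block_set_nonempty.
exact: op_series_ub.
Qed.

End Corner.

Section Ell1SumTest.
Context {R : realType} (Y : nat -> mnSpace R) (H : hilbertType R).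

(** Replacing [v m] by 0 from [M] on keeps the family completely contractive and makes the partial
    sums eventually constant, so the supremum dominates finite sums. *)
Lemma ell1sum_ge (v : forall m, {linear Y m -> BHspace H}) n
    (x : 'M[ell1sum Y]_n) (h : 'I_n -> H) M :
  (forall m, completely_contractive (v m)) -> l2n h <= 1 ->
  l2n (fun i => \sum_j \sum_(0 <= m < M) BH_fun (v m (ell1sum_seq (x i j) m)) (h j))
    <= mnorm x.
Proof.
move=> v1 h1.
pose u m : {linear Y m -> BHspace H} := if (m < M)%N then v m else \0.
have u1 m : completely_contractive (u m).
  rewrite /u; case: ifP => // _ k y.
  rewrite (_ : map_mx _ _ = 0) ?mnorm0 ?mnorm_ge0//.
  by apply/matrixP => i j; rewrite !mxE.
apply: (@le_trans _ _ (block_norm (map_mx (op_series u) x))); last first.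
  apply: ub_le_sup; first exact: ell1sum_set_ub.
  by exists H, u.
apply: ub_le_sup; first by eexists; exact: op_series_ub.
exists h => //; congr l2n; apply/funext => i; apply: eq_bigr => j _.
rewrite mxE /op_series; apply/cvg_lim => //.
apply: cvg_near_cst; exists M => // N /= MN.
rewrite /series /= (big_cat_nat (leq0n _) MN) /= [X in _ + X](_ : _ = 0) ?addr0.
  rewrite [LHS]big_nat [RHS]big_nat; apply: eq_bigr => m /andP[_ mM].
  by rewrite /u mM.
by rewrite big_nat big1// => m /andP[Mm _]; rewrite /u ltnNge Mm.
Qed.

End Ell1SumTest.

Section ScalarOperators.
Context {R : realType} (U : lmodType R[i]) (f : {linear U -> R[i]^o}) (c : R[i]).

(** A multiple of a functional as an operator on a one-dimensional Hilbert space, the form in which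
    it can test the norm of an l_1-sum. *)
Definition scalar_op (y : U) : BHspace (euclidH R 1) := opmx (c * f y)%:M.

Lemma scalar_op_is_linear : linear scalar_op.
Proof.
move=> a x y; rewrite /scalar_op -linearP /=; congr opmx.
rewrite linearP mulrDr raddfD /= scale_scalar_mx; congr (_%:M + _).
by rewrite mulrCA.
Qed.
HB.instance Definition _ := GRing.isLinear.Build R[i] U (BHspace (euclidH R 1))
  _ scalar_op scalar_op_is_linear.

Lemma scalar_opE y (h : euclid R 1) :
  BH_fun (scalar_op y) h = (c * f y) *: h.
Proof. by rewrite /= /mulmx_euclid mul_scalar_mx. Qed.

End ScalarOperators.

Lemma nrm_euclid1 (R : realType) (x : euclid R 1) : nrm x = cabs (x 0 0).
Proof.
by rewrite nrm_euclid /l2n big_ord1 sqrtr_sqr ger0_norm ?nrm_ge0// -cabs_nrm.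
Qed.

(** * Norm estimates in the renormings and their l_1-sum *)

Section Renormed.
Context {R : realType} {V W : normedModType R[i]} (Q : {linear MAX V -> MIN W}).

Lemma renorm_cc_MAX m (H : hilbertType R) (v : {linear V -> BHspace H}) :
  contractive v -> @completely_contractive R (renorm Q m) (BHspace H) v.
Proof.
move=> v1 k y; apply: (@le_trans _ _ (@mnorm R (MAX V) k y)).
  by apply: ub_le_sup; [exact: MAX_set_ub|exists H, v].
by rewrite [leRHS]/mnorm /= /renorm_norm le_max lexx.
Qed.

Lemma contractive_scalar_op (phi : {linear V -> R[i]^o}) : dual_ball phi ->
  contractive (scalar_op phi 1).
Proof.
move=> phi1 y.
rewrite [leRHS](_ : _ = \sum_(i < 1) \sum_(j < 1) nrm y); last by rewrite !big_ord1.
apply: (@block_norm_le R (euclidH R 1) 1 _ (fun _ _ => nrm y)).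
  by move=> *; exact: nrm_ge0.
move=> i j h; rewrite !mxE (scalar_opE phi 1 y h) mul1r nrmZ.
by rewrite ler_wpM2r ?nrm_ge0// -lecR -cabsE -nrmE phi1.
Qed.

(** The factor 2^m is affordable because the renorming contains 2^m times the MIN norm of Q y, and
    [phi] is one of the functionals in the supremum defining that norm. *)
Lemma renorm_cc_MIN m (f : {linear V -> R[i]^o}) (phi : {linear W -> R[i]^o}) :
  dual_ball phi -> (forall y, f y = phi (Q y)) ->
  @completely_contractive R (renorm Q m) (BHspace (euclidH R 1))
    (scalar_op f (2 ^+ m)).
Proof.
move=> phi1 fE k y.
apply: (@le_trans _ _ (2 ^+ m * @mnorm R (MIN W) k (map_mx Q y))); last first.
  by rewrite [leRHS]/mnorm /= /renorm_norm le_max lexx orbT.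
apply: (@le_trans _ _ (2 ^+ m * scal_norm (map_mx phi (map_mx Q y)))); last first.
  rewrite ler_wpM2l ?exprn_ge0//; apply: ub_le_sup; first exact: MIN_set_ub.
  by exists phi.
apply: ge_sup; first exact: block_set_nonempty.
move=> _ [h h1 <-].
(* Vectors over the one-dimensional Hilbert space become scalar vectors with the same [l2n]. *)
pose h' : 'I_k -> R[i]^o := fun j => (h j : euclid R 1) 0 0.
have h'1 : l2n h' = l2n h.
  rewrite /l2n; congr Num.sqrt; apply: eq_bigr => j _.
  by rewrite [in RHS](@nrm_euclid1 R).
apply: (@le_trans _ _ (2 ^+ m * l2n (block_app (map_mx *%R (map_mx phi (map_mx Q y))
     : 'M[R[i]^o -> R[i]^o]_k) h'))); last first.
  rewrite ler_wpM2l ?exprn_ge0//; apply: ub_le_sup; first exact: scal_ub.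
  by exists h' => //=; rewrite h'1.
rewrite le_eqVlt; apply/orP; left; apply/eqP.
have -> : 2 ^+ m = cabs (2 ^+ m : R[i]) :> R.
  have -> : 2 ^+ m = (2 ^+ m)%:C%C :> R[i] by rewrite rmorphXn rmorph_nat.
  by rewrite cabs_real ger0_norm// exprn_ge0.
rewrite -l2nZ /l2n; congr Num.sqrt; apply: eq_bigr => i _; congr (_ ^+ 2).
rewrite [LHS](@nrm_euclid1 R) -cabs_nrm; congr cabs.
rewrite /block_app summxE /GRing.scale /= mulr_sumr; apply: eq_bigr => j _.
transitivity (((2 ^+ m * f (y i j)) *: (h j : euclid R 1)) 0 0).
  by rewrite -scalar_opE !mxE.
by rewrite !mxE fE mulrA.
Qed.

Context {n : nat} (i0 : 'I_n).

Lemma Zspace_corner_ge (A : forall m, {linear V -> R[i]^o}) (c : nat -> R[i])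
    (z : Zspace Q) M :
  (forall m, @completely_contractive R (renorm Q m.+1) (BHspace (euclidH R 1))
    (scalar_op (A m) (c m))) ->
  cabs (\sum_(0 <= m < M) c m * A m (ell1sum_seq z m)) <=
  mnorm (corner i0 z : 'M[Zspace Q]_n).
Proof.
move=> cc.
pose v m : {linear renorm Q m.+1 -> BHspace (euclidH R 1)} := scalar_op (A m) (c m).
pose one : euclidH R 1 := (const_mx 1 : 'cV_1) : euclid R 1.
have one1 : nrm one = 1 by rewrite [LHS](@nrm_euclid1 R) mxE (cabs_real 1) normr1.
have h1 : l2n (delta_vec i0 one) <= 1 by rewrite l2n_delta_vec one1.
apply: le_trans (ell1sum_ge (v := v) (corner i0 z : 'M[Zspace Q]_n) M cc h1).
apply: le_trans; last exact: (nrm_le_l2n _ i0).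
rewrite /= (bigD1 i0)//= [X in _ + X]big1 ?addr0 => [|j jj]; last first.
  rewrite /delta_vec (negPf jj) mulr0n big1// => m _.
  by rewrite /mulmx_euclid mulmx0.
rewrite [leRHS](@nrm_euclid1 R) summxE le_eqVlt; apply/orP; left; apply/eqP.
congr cabs; apply: eq_bigr => m _.
by rewrite /mulmx_euclid mul_scalar_mx !mxE /delta_vec !eqxx !mulr1n !mxE mulr1.
Qed.

(** Norming functionals of all [Q]-coordinates, each with its full weight, are tested at once, so
    the weighted norms add up. The exponent [m.+1] is the shift in [Zspace]. *)
Lemma Zspace_corner_ge_Q (z : Zspace Q) M :
  \sum_(0 <= m < M) 2 ^+ m.+1 * nrm (Q (ell1sum_seq z m) : W) <=
  mnorm (corner i0 z : 'M[Zspace Q]_n).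
Proof.
have ex m : exists phi : {linear W -> R[i]^o},
    dual_ball phi /\ phi (Q (ell1sum_seq z m)) = (nrm (Q (ell1sum_seq z m) : W))%:C%C.
  by have [phi ? ?] := norming (Q (ell1sum_seq z m) : W); exists phi.
have [phi phiP] := choice ex.
pose f m : {linear V -> R[i]^o} := (phi m \o Q : MAX V -> R[i]^o).
apply: le_trans (Zspace_corner_ge (A := f) (c := fun m => 2 ^+ m.+1) z M _).
  rewrite (_ : \sum_(0 <= m < M) _ = (\sum_(0 <= m < M) 2 ^+ m.+1 *
     nrm (Q (ell1sum_seq z m) : W))%:C%C).
    by rewrite cabs_real ler_norm.
  rewrite (rmorph_sum (real_complex R)); apply: eq_bigr => m _.
  by rewrite rmorphM rmorphXn rmorph_nat; congr (_ * _); exact: (phiP m).2.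
by move=> m; exact: (@renorm_cc_MIN m.+1 (f m) (phi m) (phiP m).1).
Qed.

Lemma Zspace_corner_ge_coord (z : Zspace Q) m :
  nrm (ell1sum_seq z m : V) <= mnorm (corner i0 z : 'M[Zspace Q]_n).
Proof.
have [phi phi1 phiz] := norming (ell1sum_seq z m : V).
pose f k : {linear V -> R[i]^o} := if k == m then phi else \0.
have f1 k : dual_ball (f k).
  by rewrite /f; case: ifP => // _ e; rewrite normr0.
apply: le_trans (Zspace_corner_ge (A := f) (c := fun=> 1) z m.+1 _); last first.
  by move=> k; exact: renorm_cc_MAX (contractive_scalar_op (f1 k)).
rewrite big_nat_recr //= big_nat big1 => [|k /andP[_ km]].
  by rewrite add0r mul1r /f eqxx phiz cabs_real ler_norm.
by rewrite /f (ltn_eqF km) mulr0.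
Qed.

Lemma MAX_mnorm1_le (y : MAX V) : mnorm1 y <= nrm (y : V).
Proof.
rewrite /mnorm1; set x := const_mx y.
rewrite [leLHS]/mnorm /= /MAXnorm.
have [ne|/nonemptyPn ->] := pselect (MAX_set x !=set0); last by rewrite sup0 nrm_ge0.
apply: ge_sup => // _ [H [u [u1 ->]]].
by rewrite map_const_mx; exact: u1.
Qed.

Lemma MIN_mnorm1_le (y : MIN W) : mnorm1 y <= nrm (y : W).
Proof.
rewrite /mnorm1 (_ : const_mx y = corner ord0 y); first exact: MIN_corner_le.
by apply/matrixP => i j; rewrite !mxE !ord1.
Qed.

Lemma mnorm1_renorm_le m (y : renorm Q m) :
  mnorm1 y <= nrm (y : V) + 2 ^+ m * nrm (Q y : W).
Proof.
rewrite [leLHS]/mnorm1 /mnorm /= /renorm_norm map_const_mx ge_max.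
have h1 := MAX_mnorm1_le y; have h2 := MIN_mnorm1_le (Q y).
have p0 : 0 <= 2 ^+ m :> R by rewrite exprn_ge0.
apply/andP; split.
  by apply: (le_trans h1); rewrite lerDl mulr_ge0 ?nrm_ge0.
apply: (@le_trans _ _ (2 ^+ m * nrm (Q y : W))); first by rewrite ler_wpM2l.
by rewrite lerDr nrm_ge0.
Qed.

End Renormed.

(** * Coordinates of an embedding of MIN(l_2) *)

Section WeaklyNull.
Context {R : realType}.

Lemma nneseries_le_bound (u : nat -> R) C : (forall j, 0 <= u j) ->
  (forall N, \sum_(0 <= j < N) u j <= C) -> (\sum_(j <oo) (u j)%:E <= C%:E)%E.
Proof.
move=> u0 uC; apply: lime_le; first by apply: is_cvg_nneseries => j _ _; rewrite lee_fin.
by apply: nearW => N; rewrite sumEFin lee_fin.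
Qed.

Lemma ell1_nrm_le (x : ell1 R) C :
  (forall N, \sum_(0 <= t < N) cabs ((x : ell (lexx 1)) t) <= C) -> nrm x <= C.
Proof.
move=> xC; rewrite -lee_fin (@ell_nrmE R 1 (lexx 1)) invr1 poweRe1; last first.
  by apply: nneseries_ge0 => t _ _; rewrite lee_fin powR_ge0.
under eq_eseriesr do rewrite powRr1 ?cabs_ge0//.
by apply: nneseries_le_bound => // t; exact: cabs_ge0.
Qed.

Lemma functional_delta_small (phi : {linear ell2 R -> R[i]^o}) C eps :
  (forall x, cabs (phi x) <= C * nrm x) -> 0 < eps ->
  \forall k \near \oo, cabs (phi (ell2_delta k)) <= eps.
Proof.
move=> phiC eps0; have eps20 : 0 < eps ^+ 2 by rewrite exprn_gt0.
have [|M _ hM] := bounded_series_tail (C := C ^+ 2) 0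
    (fun k => sqr_ge0 (cabs (phi (ell2_delta k)))) _ eps20.
  by move=> M; apply: bessel_delta => //; exact: iota_uniq.
exists M => // k /= Mk; rewrite -ler_sqr ?nnegrE ?cabs_ge0 ?(ltW eps0)//.
apply: le_trans (hM k.+1); rewrite big_nat_recr//= lerDr.
by apply: sumr_ge0 => j _; exact: sqr_ge0.
Qed.

(* The Schur property of l_1, for bounded images of the unit vectors of l_2. *)
Lemma ell1_delta_small (T : {linear ell2 R -> ell1 R}) C eps :
  (forall x, nrm (T x) <= C * nrm x) -> 0 < eps ->
  \forall k \near \oo, nrm (T (ell2_delta k)) <= eps.
Proof.
move=> TC eps0.
(* The hump glides over the coordinates of l_1; each is a bounded functional on l_2, hence small at
   late unit vectors by Bessel's inequality. *)
pose p j (x : ell2 R) : R := cabs ((T x : ell (lexx 1)) j).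
have pj j : exists2 phi : {linear ell2 R -> R[i]^o},
    forall x, phi x = (T x : ell (lexx 1)) j & True.
  pose phi (x : ell2 R) : R[i]^o := (T x : ell (lexx 1)) j.
  have phil : linear phi by move=> a x y; rewrite /phi linearP.
  pose phiL := GRing.isLinear.Build _ _ _ _ phi phil.
  pose Phi : {linear ell2 R -> R[i]^o} := HB.pack phi phiL.
  by exists Phi.
have pT x N : \sum_(0 <= j < N) p j x <= nrm (T x) by exact: ell1_coords_le.
have : \forall k \near \oo, forall N, \sum_(0 <= j < N) p j (ell2_delta k) <= eps.
  apply: (@gliding_hump R p C) => //.
  - by move=> j x; exact: cabs_ge0.
  - by move=> j x; have [phi phiE _] := pj j; rewrite /p -!phiE linearN /cabs normrN.
  - by move=> j x y; have [phi phiE _] := pj j; rewrite /p -!phiE linearD cabsD.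
  - by move=> x N; exact: le_trans (pT x N) (TC x).
  - move=> j e e0; have [phi phiE _] := pj j.
    have phiC x : cabs (phi x) <= C * nrm x.
      rewrite phiE (le_trans _ (TC x))// (le_trans _ (pT x j.+1))//.
      by rewrite big_nat_recr//= lerDr; apply: sumr_ge0 => i _; exact: cabs_ge0.
    by have := functional_delta_small phiC e0; apply: filterS => k; rewrite phiE.
by apply: filterS => k; exact: ell1_nrm_le.
Qed.

End WeaklyNull.

Section CoordinatesOfEmbedding.
Context {R : realType} {V : normedModType R[i]}
  (Q : {linear MAX V -> MIN (ell2 R)}).

Section Coordinate.
Variables (f : {linear MIN (ell2 R) -> Zspace Q}) (m : nat).

Definition Zcoord (x : ell2 R) : V := ell1sum_seq (f x) m.

Lemma Zcoord_is_linear : linear Zcoord.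
Proof. by move=> a x y; rewrite /Zcoord linearP. Qed.
HB.instance Definition _ := GRing.isLinear.Build R[i] (ell2 R) V _ Zcoord
  Zcoord_is_linear.

Definition Qcoord (x : ell2 R) : ell2 R := Q (Zcoord x).

Lemma Qcoord_is_linear : linear Qcoord.
Proof. by move=> a x y; rewrite /Qcoord (linearP Zcoord) (linearP Q). Qed.
HB.instance Definition _ := GRing.isLinear.Build R[i] (ell2 R) (ell2 R) _ Qcoord
  Qcoord_is_linear.

End Coordinate.

Lemma ell1bound_approx (z : Zspace Q) eps : 0 < eps ->
  exists M, ell1bound z <= \sum_(0 <= m < M) mnorm1 (ell1sum_seq z m) + eps.
Proof.
move=> eps0; apply: contrapT => nM.
have : ell1bound z <= ell1bound z - eps.
  have zy : (\sum_(m <oo) (mnorm1 (ell1sum_seq z m))%:E < +oo)%E.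
    by have := valP z; rewrite inE.
  rewrite -lee_fin [X in (X%:E <= _)%E]/ell1bound fineK; last first.
    rewrite ge0_fin_numE//; apply: nneseries_ge0 => m _ _.
    by rewrite lee_fin mnorm1_ge0.
  apply: nneseries_le_bound => [m|M]; first exact: mnorm1_ge0.
  by rewrite leNgt; apply/negP => h; apply: nM; exists M; rewrite -lerBlDr ltW.
by move=> h; lra.
Qed.

(** The gliding hump over the summands of the l_1-sum. A single summand is small at late unit
    vectors because its coordinate passes through l_1 by [T1], where [ell1_delta_small] applies. *)
Lemma Zspace_Q_delta_small (f : {linear MIN (ell2 R) -> Zspace Q}) K n (i0 : 'I_n)
    (T1 : {linear V -> ell1 R}) (T2 : {linear ell1 R -> ell2 R}) eps :
  bounded_map T1 -> bounded_map T2 -> Q = T2 \o T1 :> (V -> ell2 R) ->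
  0 <= K -> (forall x : 'M[MIN (ell2 R)]_n, mnorm (map_mx f x) <= K * mnorm x) ->
  0 < eps ->
  \forall k \near \oo, forall M, \sum_(0 <= m < M)
    2 ^+ m.+1 * nrm (Qcoord f m (ell2_delta k)) <= eps.
Proof.
move=> [K1 T1K] [K2 T2K] QE K0 fK eps0.
have cf x : mnorm (corner i0 (f x) : 'M[Zspace Q]_n) <= K * nrm (x : ell2 R).
  rewrite -map_corner (le_trans (fK _))// ler_wpM2l//; exact: MIN_corner_le.
pose p m (x : ell2 R) : R := 2 ^+ m.+1 * nrm (Qcoord f m x).
apply: (@gliding_hump R p K) => //.
- by move=> m x; rewrite mulr_ge0 ?exprn_ge0 ?nrm_ge0.
- by move=> m x; rewrite /p linearN nrmN.
- move=> m x y; rewrite /p linearD -mulrDr.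
  by rewrite ler_wpM2l ?exprn_ge0// nrmD.
- move=> x M; apply: le_trans (cf x); exact: Zspace_corner_ge_Q.
- move=> m e e0.
  pose TT : {linear ell2 R -> ell1 R} := T1 \o Zcoord f m.
  have TC x : nrm (TT x) <= `|K1| * K * nrm x.
    rewrite (le_trans (T1K _))// -mulrA.
    apply: (@le_trans _ _ (`|K1| * nrm (Zcoord f m x))).
      by rewrite ler_wpM2r ?nrm_ge0 ?ler_norm.
    rewrite ler_wpM2l//; apply: le_trans (cf x); exact: Zspace_corner_ge_coord.
  pose c := 2 ^+ m.+1 * (`|K2| + 1).
  have c0 : 0 < c by rewrite mulr_gt0 ?exprn_gt0// ltr_wpDl.
  have := ell1_delta_small TC (divr_gt0 e0 c0); apply: filterS => k hk.
  rewrite /p /Qcoord QE /=.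
  apply: (@le_trans _ _ (c * nrm (TT (ell2_delta k)))).
    rewrite /c -mulrA ler_wpM2l ?exprn_ge0// (le_trans (T2K _))//.
    by rewrite ler_wpM2r ?nrm_ge0// (le_trans (ler_norm _))// lerDl.
  by rewrite -ler_pdivlMl// mulrC.
Qed.

End CoordinatesOfEmbedding.

(** * Testing an embedding against the maximally entangled vector *)

Section MaximallyEntangledTest.
Context {R : realType} {d n : nat} (a : 'I_d -> 'M[R]_n).
Hypothesis aP : car a.

Lemma scal_norm_le (A : 'M[R[i]]_n) C :
  (forall v : 'cV[R[i]]_n, nrm (A *m v : euclid R n) <= C * nrm (v : euclid R n)) ->
  0 <= C -> scal_norm A <= C.
Proof.
move=> AC C0; apply: ge_sup; first exact: block_set_nonempty.
move=> _ [h h1 <-].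
pose v : 'cV[R[i]]_n := \col_j h j.
have vh : nrm (v : euclid R n) = l2n h.
  by rewrite nrm_euclid; congr l2n; apply/funext => j; rewrite /coords mxE.
have -> : l2n (block_app (map_mx *%R A : 'M[R[i]^o -> R[i]^o]_n) h)
    = nrm (A *m v : euclid R n).
  rewrite nrm_euclid; congr l2n; apply/funext => i.
  by rewrite /coords /block_app mxE; apply: eq_bigr => j _; rewrite !mxE.
by rewrite (le_trans (AC _))// ler_piMr// vh.
Qed.

(** The tensor sum_p a_p (x) e_p, written entrywise. *)
Definition car_tensor (V : lmodType R[i]) (e : 'I_d -> V) : 'M[V]_n :=
  \matrix_(i, j) \sum_p (a p i j)%:C%C *: e p.

Lemma lincombE (c : 'I_d -> R[i]) i j :
  lincomb a c i j = \sum_q c q * (a q i j)%:C%C.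
Proof. by rewrite /lincomb summxE; apply: eq_bigr => q _; rewrite !mxE. Qed.

(** A functional of norm at most 1 turns the tensor into a combination of the a_p whose coefficients
    have l_2 norm at most 1 by Bessel's inequality; [lincomb_le] then applies. *)
Lemma MIN_car_tensor_le1 (k : 'I_d -> nat) : injective k ->
  mnorm (car_tensor (fun p => ell2_delta (k p) : ell2 R) : 'M[MIN (ell2 R)]_n) <= 1.
Proof.
move=> kI; apply: ge_sup.
  exists (scal_norm (map_mx (\0 : {linear ell2 R -> R[i]^o})
    (car_tensor (fun p => ell2_delta (k p) : ell2 R)))).
  by exists \0 => //= e; rewrite normr0.
move=> _ [phi phi1 <-].
pose c p : R[i] := phi (ell2_delta (k p)).
have -> : map_mx phi (car_tensor (fun p => ell2_delta (k p) : ell2 R)) = lincomb a c.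
  apply/matrixP => i j; rewrite lincombE !mxE linear_sum; apply: eq_bigr => p _.
  by rewrite linearZ /= mulrC.
apply: scal_norm_le => // v; rewrite (le_trans (lincomb_le _ _ aP))//.
rewrite ler_wpM2r ?nrm_ge0// -[leRHS](@sqrtr1 R) ler_wsqrtr//.
have phiC x : cabs (phi x) <= 1 * nrm x by rewrite mul1r -lecR -cabsE -nrmE phi1.
have := bessel_delta (s := map k (index_enum 'I_d)) phiC.
rewrite big_map expr1n; apply; rewrite map_inj_uniq//; exact: index_enum_uniq.
Qed.

Section TestMap.
Context {V : normedModType R[i]} (psi : 'I_d -> {linear V -> R[i]^o}).
Hypothesis psi1 : forall q, dual_ball (psi q).

Definition test_mx (y : V) : 'M[R[i]]_n :=
  lincomb a (fun q => (Num.sqrt d%:R)^-1%:C%C * psi q y).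

Lemma test_mx_is_linear : linear test_mx.
Proof.
move=> c x y; apply/matrixP => i j; rewrite !mxE !lincombE mulr_sumr -big_split.
apply: eq_bigr => q _ /=; rewrite linearP -[X in _ * (X + _)]/(c * psi q x).
by rewrite mulrDr mulrDl; congr (_ + _); rewrite mulrCA -mulrA.
Qed.
HB.instance Definition _ := GRing.isLinear.Build R[i] V 'M[R[i]]_n _ test_mx
  test_mx_is_linear.

(** Each of the d coefficients is at most d^(-1/2) |y|, so their l_2 norm is at most |y|; this fixes
    the normalisation in [test_mx]. *)
Lemma contractive_test : contractive (fun y => opmx (test_mx y) : BHspace (euclidH R n)).
Proof.
apply: contractive_opmx => y h; rewrite (le_trans (lincomb_le _ _ aP))//.
rewrite ler_wpM2r ?nrm_ge0// -[leRHS]ger0_norm ?nrm_ge0// -sqrtr_sqr ler_wsqrtr//.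
apply: (@le_trans _ _ (\sum_(q < d) (d%:R)^-1 * nrm y ^+ 2)).
  apply: ler_sum => q _; rewrite cabsM exprMn cabs_real normfV.
  rewrite ger0_norm ?sqrtr_ge0// exprVn sqr_sqrtr// ler_wpM2l ?invr_ge0//.
  by rewrite ler_sqr ?nnegrE ?cabs_ge0 ?nrm_ge0// -lecR -cabsE -nrmE psi1.
rewrite sumr_const card_ord -mulrnAl -[_ *+ d]mulr_natr.
have [->|d0] := eqVneq (d%:R : R) 0; first by rewrite mulr0 mul0r sqr_ge0.
by rewrite mulVf// mul1r.
Qed.

End TestMap.

Lemma car_embedding_le (V : normedModType R[i]) (Q : {linear MAX V -> MIN (ell2 R)})
    (f : {linear MIN (ell2 R) -> Zspace Q}) K (k : 'I_d -> nat) M :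
  (0 < d)%N -> (0 < n)%N -> injective k -> 0 <= K ->
  (forall x : 'M[MIN (ell2 R)]_n, mnorm (map_mx f x) <= K * mnorm x) ->
  \sum_(0 <= m < M) \sum_p nrm (Zcoord f m (ell2_delta (k p))) <=
    2 * Num.sqrt d%:R * K.
Proof.
move=> d0 n0 kI K0 fK.
pose g p m : V := Zcoord f m (ell2_delta (k p)).
have ex m q : exists phi : {linear V -> R[i]^o},
    dual_ball phi /\ phi (g q m) = (nrm (g q m))%:C%C.
  by have [phi ? ?] := norming (g q m); exists phi.
have [psi' psi'P] := choice (fun mq : nat * 'I_d => ex mq.1 mq.2).
pose psi m q := psi' (m, q).
have psi1 m q : dual_ball (psi m q) := (psi'P (m, q)).1.
have psig m q : psi m q (g q m) = (nrm (g q m))%:C%C := (psi'P (m, q)).2.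
pose A m : {linear V -> 'M[R[i]]_n} := test_mx (psi m).
pose v0 m : {linear V -> BHspace (euclidH R n)} := @opmx R n \o A m.
pose v m : {linear renorm Q m.+1 -> BHspace (euclidH R n)} := v0 m.
have vc m : @completely_contractive R (renorm Q m.+1) (BHspace (euclidH R n)) (v m).
  by apply: renorm_cc_MAX; exact: (contractive_test (psi1 m)).
have nR0 : 0 < n%:R :> R by rewrite ltr0n.
have dR0 : 0 < d%:R :> R by rewrite ltr0n.
have sn0 : 0 < Num.sqrt n%:R :> R by rewrite sqrtr_gt0.
have sd0 : 0 < Num.sqrt d%:R :> R by rewrite sqrtr_gt0.
pose r : R[i] := (Num.sqrt n%:R)^-1%:C%C.
(* The blocks of the maximally entangled unit vector n^(-1/2) sum_j e_j (x) e_j. *)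
pose h (j : 'I_n) : euclidH R n := (r *: delta_mx j 0 : 'cV[R[i]]_n) : euclid R n.
have h1 : l2n h <= 1.
  have hj j : nrm (h j) ^+ 2 = n%:R^-1.
    rewrite [nrm _](nrmZ r (delta_mx j 0 : euclid R n)) cabs_real ger0_norm ?invr_ge0//.
    rewrite (_ : nrm _ = 1) ?mulr1 ?exprVn ?sqr_sqrtr//.
    rewrite nrm_euclid (_ : coords _ = delta_vec j (1 : R[i]^o)).
      by rewrite l2n_delta_vec -cabs_nrm (cabs_real 1) normr1.
    by apply/funext => i; rewrite /coords /delta_vec mxE eqxx andbT.
  rewrite /l2n; under eq_bigr do rewrite hj.
  by rewrite sumr_const card_ord -[_ *+ n]mulr_natr mulVf ?gt_eqF// sqrtr1.
pose X := car_tensor (fun p => ell2_delta (k p) : ell2 R).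
have := @ell1sum_ge R (fun m => renorm Q m.+1) (euclidH R n) v n (map_mx f X) h M vc h1.
set w := fun i : 'I_n => _.
move=> hw.
have {hw} wK : l2n w <= K.
  apply: (le_trans hw); apply: (le_trans (fK X)).
  by rewrite ler_piMr//; exact: MIN_car_tensor_le1.
pose S := \sum_(0 <= m < M) \sum_p nrm (g p m).
(* Pairing [w] with sum_i e_i (x) e_i produces the sums of [car_trace]: mixed terms vanish, and each
   p = q leaves n/2 times a norm attained by [psi]. *)
have wS : \sum_i (w i : euclid R n) i 0 =
    ((Num.sqrt n%:R)^-1 * (Num.sqrt d%:R)^-1 * (n%:R / 2) * S)%:C%C.
  pose G m q p : R[i] := psi m q (g p m).
  pose s : R[i] := (Num.sqrt d%:R)^-1%:C%C.
  have AE m i j : A m (ell1sum_seq (map_mx f X i j) m) i j =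
      \sum_q \sum_p s * G m q p * (a p i j * a q i j)%:C%C.
    rewrite [map_mx f X i j]mxE -/(Zcoord f m (X i j)) mxE linear_sum.
    rewrite /A /test_mx lincombE; apply: eq_bigr => q _.
    rewrite linear_sum mulr_sumr mulr_suml; apply: eq_bigr => p _.
    have -> : psi m q (Zcoord f m ((a p i j)%:C%C *: ell2_delta (k p))) =
        (a p i j)%:C%C * G m q p by rewrite !linearZ.
    by rewrite realcM -/s; ring.
  have opE m i j y : (BH_fun (v m y) (h j) : euclid R n) i 0 = r * A m y i j.
    by rewrite /= /mulmx_euclid -scalemxAr mxE -colE mxE.
  have wE i : (w i : euclid R n) i 0 = \sum_j \sum_(0 <= m < M)
       r * \sum_q \sum_p s * G m q p * (a p i j * a q i j)%:C%C.
    rewrite /w summxE; apply: eq_bigr => j _; rewrite summxE.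
    by apply: eq_bigr => m _; rewrite opE AE.
  have tr p q : \sum_(ij : 'I_n * 'I_n) (a p ij.1 ij.2 * a q ij.1 ij.2)%:C%C =
      ((p == q)%:R * (n%:R / 2))%:C%C.
    rewrite -(rmorph_sum (real_complex R)) /=; congr (_%:C%C).
    rewrite -(pair_big xpredT xpredT (fun i j => a p i j * a q i j)) /=.
    by rewrite mulrA -(car_trace p q aP) -mulr_natr mulfK.
  under eq_bigr do rewrite wE.
  rewrite pair_big exchange_big /= /S realcM (rmorph_sum (real_complex R)) mulr_sumr.
  apply: eq_bigr => m _.
  rewrite -mulr_sumr exchange_big /= (rmorph_sum (real_complex R)) !mulr_sumr.
  apply: eq_bigr => q _; rewrite exchange_big /= (bigD1 q)//=.
  rewrite [X in r * (_ + X)]big1 => [|p pq].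
    rewrite addr0 -mulr_sumr tr eqxx mul1r /G psig !realcM -/r -/s.
    by ring.
  by rewrite -mulr_sumr tr (negPf pq) mul0r mulr0.
have : (Num.sqrt n%:R)^-1 * (Num.sqrt d%:R)^-1 * (n%:R / 2) * S <= Num.sqrt n%:R * K.
  apply: (@le_trans _ _ (cabs (\sum_i (w i : euclid R n) i 0))).
    by rewrite wS cabs_real ler_norm.
  rewrite cabs_nrm (le_trans (nrm_sum _ _ _))//.
  apply: (@le_trans _ _ (l2n w * Num.sqrt n%:R)); last first.
    by rewrite mulrC ler_wpM2l// ltW.
  (* Cauchy-Schwarz against the all-ones vector, of norm sqrt n. *)
  apply: (@le_trans _ _ (\sum_(i < n) nrm (w i) * 1)).
    by apply: ler_sum => i _; rewrite mulr1; exact: (cabs_coord_le (w i : euclid R n)).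
  apply: (@l2n_cauchy R n); rewrite ?l2n_ge0 ?l2n_sqr ?sqrtr_ge0//.
  by rewrite sqr_sqrtr// sumr_const card_ord expr1n.
(* With N = n and t = sqrt n this cancels the matrix size from the estimate, leaving only d. *)
have e : forall t u N y : R, 0 < t -> 0 < u -> N = t * t ->
    t^-1 * u^-1 * (N / 2) * y = t * (y / (2 * u)).
  by move=> t u N y t0 u0 ->; field; rewrite !gt_eqF.
rewrite (e _ _ _ S sn0 sd0) -?expr2 ?sqr_sqrtr// ler_pM2l// ler_pdivrMr ?mulr_gt0//.
by rewrite mulrC.
Qed.

End MaximallyEntangledTest.

(** * Choice of the constants and the contradiction for large d *)

Theorem lemma3p3 (R : realType)
    (Q : {linear MAX (L1 R) -> MIN (ell2 R)})
    (Q_cb : completely_bounded Q)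
    (Q_surj : range Q = setT)
    (T1 : {linear L1 R -> ell1 R}) (T1_bounded : bounded_map T1)
    (T1_surj : range T1 = setT)
    (T2 : {linear ell1 R -> ell2 R}) (T2_bounded : bounded_map T2)
    (T2_surj : range T2 = setT)
    (Q_comp : Q = T2 \o T1 :> (L1 R -> ell2 R)) :
  ~ almost_ci_embeds (MIN (ell2 R)) (Zspace Q).
Proof.
move=> [f [K [L fP]]].
pose K' := `|K| + 1; pose L' := `|L| + 1.
have K'0 : 0 < K' by rewrite ltr_wpDl.
have L'0 : 0 < L' by rewrite ltr_wpDl.
(* The two estimates will give d / (2 L') <= 2 sqrt(d) K', that is sqrt d <= [b]; [d] is chosen to
   violate this. *)
pose b := 4 * K' * L'.
have b0 : 0 < b by rewrite !mulr_gt0.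
pose d := Num.bound (b ^+ 2).
have bd : b ^+ 2 < d%:R by rewrite archi_boundP// sqr_ge0.
have dR0 : 0 < d%:R :> R by exact: le_lt_trans (sqr_ge0 b) bd.
have d0 : (0 < d)%N by rewrite -(ltr0n R).
have [n [a [n0 aP]]] := car_exists R d.
(* Only the map [f n] is used, at the size [n] of the generators; its bounds do not depend on [n],
   so [d] could be fixed first. *)
have [_ fK fL] := fP n n0.
have {}fK (x : 'M[MIN (ell2 R)]_n) : mnorm (map_mx (f n) x) <= K' * mnorm x.
  rewrite (le_trans (fK x))// ler_wpM2r ?mnorm_ge0//.
  by rewrite (le_trans (ler_norm K))// lerDl.
have {}fL (x : 'M[MIN (ell2 R)]_n) : mnorm x <= L' * mnorm (map_mx (f n) x).
  rewrite (le_trans (fL x))// ler_wpM2r ?mnorm_ge0//.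
  by rewrite (le_trans (ler_norm L))// lerDl.
pose i0 : 'I_n := Ordinal n0.
(* Of the lower bound 1/L', one quarter is lost to the weighted [Q]-parts and one quarter to
   truncating the series, leaving 1/(2 L'). *)
have e0 : 0 < (4 * L')^-1 by rewrite invr_gt0 mulr_gt0.
have [k0 _ hk0] := Zspace_Q_delta_small i0 T1_bounded T2_bounded Q_comp
  (ltW K'0) fK e0.
have lower k : (k0 <= k)%N -> exists M,
    (2 * L')^-1 <= \sum_(0 <= m < M) nrm (Zcoord (f n) m (ell2_delta k)).
  move=> kk; have [M hM] := ell1bound_approx (f n (ell2_delta k)) e0.
  exists M.
  have h1 : 1 <= L' * ell1bound (f n (ell2_delta k)).
    rewrite -(@nrm_ell2_delta R k).
    apply: le_trans (MIN_corner_ge i0 _) _; apply: le_trans (fL _) _.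
    by rewrite map_corner ler_wpM2l ?(ltW L'0)//; exact: ell1sum_corner_le.
  have h2 : \sum_(0 <= m < M) mnorm1 (ell1sum_seq (f n (ell2_delta k)) m) <=
      \sum_(0 <= m < M) nrm (Zcoord (f n) m (ell2_delta k)) +
      \sum_(0 <= m < M) 2 ^+ m.+1 * nrm (Qcoord (f n) m (ell2_delta k)).
    by rewrite -big_split; apply: ler_sum => m _; exact: mnorm1_renorm_le.
  have h3 := hk0 k kk M.
  have h4 : L'^-1 <= ell1bound (f n (ell2_delta k)) by rewrite -[L'^-1]mulr1 ler_pdivrMl.
  move: hM h2 h3; rewrite !invfM; lra.
(* The indices k0 + p are distinct and late enough; their truncation points are replaced by the
   maximum [M], which only adds nonnegative terms. *)
have [N hN] := choice (fun p : 'I_d => lower (k0 + p)%N (leq_addr _ _)).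
pose M := \max_p N p.
have kI : injective (fun p : 'I_d => (k0 + p)%N).
  by move=> p q /addnI /val_inj.
have := car_embedding_le aP M d0 n0 kI (ltW K'0) fK.
apply/negP; rewrite -ltNge.
have sd0 : 0 < Num.sqrt d%:R :> R by rewrite sqrtr_gt0.
apply: (@lt_le_trans _ _ (\sum_(p < d) (2 * L')^-1)).
  have bs : b < Num.sqrt d%:R.
    by rewrite -ltr_sqr ?nnegrE ?(ltW b0) ?(ltW sd0)// sqr_sqrtr// ltW.
  rewrite sumr_const card_ord -[ltRHS]mulr_natl ltr_pdivlMr ?mulr_gt0//.
  rewrite -[ltRHS](@sqr_sqrtr R) ?(ltW dR0)// expr2.
  rewrite [ltLHS](_ : _ = Num.sqrt d%:R * b); last by rewrite /b; ring.
  by rewrite ltr_pM2l.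
rewrite exchange_big /=; apply: ler_sum => p _; apply: (le_trans (hN p)).
have NM : (N p <= M)%N by exact: leq_bigmax.
rewrite (big_cat_nat (leq0n _) NM) /= lerDl; apply: sumr_ge0 => m _.
exact: nrm_ge0.
Qed.
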